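(* Let $F=\frac1n\sum_{i=1}^nF_i$ with $F_i=\frac1m\sum_{j=1}^mF_{ij}$, and let $F$ be $\mu$-quasi-strongly monotone with $\mu>0$ and $\ell$-star-cocoercive. Assume that there are $\widehat\ell,\widetilde\ell>0$ such that for all $x\in\mathbb{R}^d$, with $x^*=\mathrm{proj}_{X^*}(x)$, $$\frac1n\sum_{i=1}^n\|F_i(x)-F_i(x^* )\|^2\le\widehat\ell\,\langle F(x)-F(x^* ),x-x^*\rangle,$$ $$\frac1{nm}\sum_{i=1}^n\sum_{j=1}^m\|F_{ij}(x)-F_{ij}(x^* )\|^2\le\widetilde\ell\,\langle F(x)-F(x^* ),x-x^*\rangle,$$ and that $X^*=\{x^*\}$ is a singleton. Suppose that $0<\alpha\le\min\left\{\frac p3,\frac1{1+\omega}\right\}$ and $$0<\gamma\le\left(\ell+\frac{10(\omega+1)(\widehat\ell+\widetilde\ell)}{n}+\frac{4(\omega+1)p\widetilde\ell}{\alpha n}\right)^{-1}.$$ Then for all $k\ge0$ the iterates of VR-DIANA-SGDA satisfy $$\mathbb{E}\|x^k-x^*\|^2\le\left(1-\min\left\{\gamma\mu,\frac\alpha2\right\}\right)^kV_0,\qquad V_0=\|x^0-x^*\|^2+\frac{4(\omega+1)\gamma^2}{n\alpha}\sigma_0^2,$$ where $\sigma_0^2=\frac1n\sum_{i=1}^n\|h_i^0-F_i(x^* )\|^2+\frac1{nm}\sum_{i=1}^n\sum_{j=1}^m\|F_{ij}(w_i^0)-F_{ij}(x^* )\|^2$.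
   Context: Norms and inner products on $\mathbb{R}^d$ are Euclidean. $F,F_i,F_{ij}:\mathbb{R}^d\to\mathbb{R}^d$ are operators and $R:\mathbb{R}^d\to\mathbb{R}\cup\{+\infty\}$ is a proper lower semicontinuous convex function. $X^*$ is the (nonempty) set of solutions of the regularized variational inequality: find $x^*\in\mathbb{R}^d$ with $\langle F(x^* ),x-x^*\rangle+R(x)-R(x^* )\ge0$ for all $x\in\mathbb{R}^d$. $\mathrm{proj}_{X^*}(x)=\arg\min_{y\in X^*}\|y-x\|$. For all $x\in\mathbb{R}^d$, with $x^*=\mathrm{proj}_{X^*}(x)$: $F$ is $\mu$-quasi-strongly monotone if $\langle F(x)-F(x^* ),x-x^*\rangle\ge\mu\|x-x^*\|^2$; $F$ is $\ell$-star-cocoercive ($\ell>0$) if $\|F(x)-F(x^* )\|^2\le\ell\langle F(x)-F(x^* ),x-x^*\rangle$. An unbiased compressor (quantization) with parameter $\omega\ge0$ is a possibly randomized map $\mathcal{Q}:\mathbb{R}^d\to\mathbb{R}^d$ with $\mathbb{E}[\mathcal{Q}(x)]=x$ and $\mathbb{E}\|\mathcal{Q}(x)-x\|^2\le\omega\|x\|^2$ for all $x$. VR-DIANA-SGDA, with $p\in(0,1]$, stepsizes $\gamma,\alpha>0$, such a $\mathcal{Q}$, deterministic starting points $x^0,h_i^0,w_i^0\in\mathbb{R}^d$, $h^0=\frac1n\sum_ih_i^0$: at iteration $k$, each $i=1,\dots,n$ draws $j_i^k$ uniformly from $\{1,\dots,m\}$ (independently of the past and across $i$) and sets $$g_i^k=F_{ij_i^k}(x^k)-F_{ij_i^k}(w_i^k)+F_i(w_i^k),$$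 $w_i^{k+1}=x^k$ with probability $p$ and $w_i^{k+1}=w_i^k$ with probability $1-p$, $\Delta_i^k=g_i^k-h_i^k$, $h_i^{k+1}=h_i^k+\alpha\mathcal{Q}(\Delta_i^k)$; then $$g^k=h^k+\frac1n\sum_{i=1}^n\mathcal{Q}(\Delta_i^k),\quad h^{k+1}=h^k+\frac\alpha n\sum_{i=1}^n\mathcal{Q}(\Delta_i^k)=\frac1n\sum_{i=1}^nh_i^{k+1},\quad x^{k+1}=\mathrm{prox}_{\gamma R}(x^k-\gamma g^k),$$ where $\mathrm{prox}_{\gamma R}(x)=\arg\min_{y}\{R(y)+\|y-x\|^2/(2\gamma)\}$. The compressions at different workers are independent, and the same realization of $\mathcal{Q}(\Delta_i^k)$ is used in all updates. *)

(* Defs.v *)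
From HB Require Import structures.
From mathcomp Require Import all_boot all_order all_algebra.
From mathcomp Require Import all_classical all_reals all_analysis.
Set Implicit Arguments.
Unset Strict Implicit.
Unset Printing Implicit Defensive.
Import Order.TTheory GRing.Theory Num.Theory.
Import numFieldNormedType.Exports.
Local Open Scope classical_set_scope.
Local Open Scope ring_scope.

(* The library norm on 'rV[R]_d is the sup norm, hence a separate Euclidean
   norm.  Both induce the same topology. *)
Definition dot (R : realType) (d : nat) (x y : 'rV[R]_d) : R :=
  \sum_(c < d) x ord0 c * y ord0 c.

Definition enorm (R : realType) (d : nat) (x : 'rV[R]_d) : R :=
  Num.sqrt (dot x x).

Definition borel (R : realType) (d : nat) :=
  g_sigma_algebraType (@open 'rV[R]_d).

Definition proper_efun (R : realType) (V : Type) (f : V -> \bar R) : Prop :=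
  (forall x, f x != -oo%E) /\ (exists x, f x != +oo%E).

Definition econvex (R : realType) (V : lmodType R) (f : V -> \bar R) : Prop :=
  forall (x y : V) (t : R), 0 < t < 1 ->
    (f (t *: x + (1 - t) *: y)%R <= t%:E * f x + (1 - t)%R%:E * f y)%E.

Definition argmin (R : realType) (V : Type) (f : V -> \bar R) (S : set V) :
    set V :=
  [set y | S y /\ forall z, S z -> (f y <= f z)%E].

Definition metric_proj (R : realType) (d : nat) (S : set 'rV[R]_d) (x : 'rV[R]_d) :
    'rV[R]_d :=
  xget 0 (argmin (fun y => (enorm (y - x))%:E) S).

Definition prox (R : realType) (d : nat) (gamma : R) (r : 'rV[R]_d -> \bar R)
    (x : 'rV[R]_d) : 'rV[R]_d :=
  xget 0 (argmin (fun y => r y + (enorm (y - x) ^+ 2 / (2 * gamma))%R%:E)%E setT).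

(* Since +oo - +oo = -oo in \bar R, a point where the proper function r is +oo
   is never a solution. *)
Definition rvi_solutions (R : realType) (d : nat) (F : 'rV[R]_d -> 'rV[R]_d)
    (r : 'rV[R]_d -> \bar R) : set 'rV[R]_d :=
  [set xs | forall x, (0 <= (dot (F xs) (x - xs)%R)%:E + r x - r xs)%E].

Definition quasi_strongly_monotone (R : realType) (d : nat)
    (X : set 'rV[R]_d) (mu : R) (F : 'rV[R]_d -> 'rV[R]_d) : Prop :=
  forall x, let xs := metric_proj X x in
    mu * enorm (x - xs) ^+ 2 <= dot (F x - F xs) (x - xs).

Definition star_cocoercive (R : realType) (d : nat)
    (X : set 'rV[R]_d) (ell : R) (F : 'rV[R]_d -> 'rV[R]_d) : Prop :=
  forall x, let xs := metric_proj X x in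
    enorm (F x - F xs) ^+ 2 <= ell * dot (F x - F xs) (x - xs).

Definition mean_op (R : realType) (d n : nat)
    (G : 'I_n -> 'rV[R]_d -> 'rV[R]_d) (x : 'rV[R]_d) : 'rV[R]_d :=
  n%:R^-1 *: \sum_(i < n) G i x.

(* The randomized map is Q x z, where z is a random seed of law nu. *)
Record unbiased_compressor (R : realType) (d : nat) (dX : measure_display)
    (Xi : measurableType dX) (nu : probability Xi R) (omega : R)
    (Q : 'rV[R]_d -> Xi -> 'rV[R]_d) : Prop := UnbiasedCompressor {
  compressor_measurable :
    measurable_fun [set: borel R d * Xi]
      (fun u : borel R d * Xi => Q u.1 u.2 : borel R d);
  compressor_mean : forall (x : 'rV[R]_d) (c : 'I_d),
    ('E_nu[fun z => Q x z ord0 c] = (x ord0 c)%:E)%E;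
  compressor_var : forall x : 'rV[R]_d,
    ('E_nu[fun z => (enorm (Q x z - x) ^+ 2)%R]
       <= (omega * enorm x ^+ 2)%R%:E)%E }.

Definition mutually_independent (R : realType) (dO : measure_display)
    (Omega : measurableType dO) (P : probability Omega R) (I : eqType)
    (E : I -> set (set Omega)) : Prop :=
  forall (s : seq I) (A : I -> set Omega), uniq s ->
    (forall i, i \in s -> E i (A i)) ->
    P (\bigcap_(i in [set` s]) A i) = (\prod_(i <- s) P (A i))%E.

(* j k i, xi k i and b k are the index drawn by worker i, the seed of its
   compressor and the vector of the n coins (true: update w_i) at iteration k.
   The coin vectors are independent of everything else, but the n coins of one
   iteration may have any joint law with marginals p, so that independent coins
   and a coin common to all workers are both covered. *)
Definition sampling_events (R : realType) (n m : nat) (dO dX : measure_display)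
    (Omega : measurableType dO) (Xi : measurableType dX)
    (P : probability Omega R)
    (j : nat -> 'I_n -> Omega -> 'I_m)
    (xi : nat -> 'I_n -> {RV P >-> Xi})
    (b : nat -> Omega -> {ffun 'I_n -> bool})
    (l : (nat * 'I_n) + (nat * 'I_n) + nat) : set (set Omega) :=
  match l with
  | inl (inl (k, i)) => preimage_set_system setT (j k i) setT
  | inl (inr (k, i)) => preimage_set_system setT (xi k i) measurable
  | inr k => preimage_set_system setT (b k) setT
  end.

Record vr_diana_sampling (R : realType) (n m : nat) (dO dX : measure_display)
    (Omega : measurableType dO) (Xi : measurableType dX)
    (P : probability Omega R) (nu : probability Xi R) (p : R)
    (j : nat -> 'I_n -> Omega -> 'I_m)
    (xi : nat -> 'I_n -> {RV P >-> Xi})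
    (b : nat -> Omega -> {ffun 'I_n -> bool}) : Prop := VrDianaSampling {
  index_measurable : forall k i (A : set 'I_m), measurable (j k i @^-1` A);
  index_uniform : forall k i (a : 'I_m),
    P (j k i @^-1` [set a]) = (m%:R^-1)%:E;
  seed_law : forall k i (A : set Xi), measurable A ->
    distribution P (xi k i) A = nu A;
  coin_measurable : forall k (A : set {ffun 'I_n -> bool}),
    measurable (b k @^-1` A);
  coin_law : forall k i, P [set t | b k t i] = p%:E;
  sampling_independent : mutually_independent P (sampling_events j xi b) }.

Record diana_state (R : realType) (d n : nat) := DianaState {
  st_x : 'rV[R]_d;
  st_h : 'rV[R]_d;
  st_hi : 'I_n -> 'rV[R]_d;
  st_w : 'I_n -> 'rV[R]_d }.

(* Qr i is the realization of the compressor at worker i. *)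
Definition vr_diana_step (R : realType) (d n m : nat)
    (Fij : 'I_n -> 'I_m -> 'rV[R]_d -> 'rV[R]_d) (r : 'rV[R]_d -> \bar R)
    (gamma alpha : R) (jr : 'I_n -> 'I_m) (Qr : 'I_n -> 'rV[R]_d -> 'rV[R]_d)
    (br : 'I_n -> bool) (s : diana_state R d n) : diana_state R d n :=
  let x := st_x s in
  let w := st_w s in
  let gi i := Fij i (jr i) x - Fij i (jr i) (w i) + mean_op (Fij i) (w i) in
  let q i := Qr i (gi i - st_hi s i) in
  let g := st_h s + n%:R^-1 *: \sum_(i < n) q i in
  {| st_x := prox gamma r (x - gamma *: g);
     st_h := st_h s + (alpha / n%:R) *: \sum_(i < n) q i;
     st_hi := fun i => st_hi s i + alpha *: q i;
     st_w := fun i => if br i then x else w i |}.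

Fixpoint vr_diana_sgda (R : realType) (d n m : nat)
    (dO dX : measure_display) (Omega : measurableType dO)
    (Xi : measurableType dX) (P : probability Omega R)
    (Fij : 'I_n -> 'I_m -> 'rV[R]_d -> 'rV[R]_d) (r : 'rV[R]_d -> \bar R)
    (gamma alpha : R) (Q : 'rV[R]_d -> Xi -> 'rV[R]_d)
    (j : nat -> 'I_n -> Omega -> 'I_m)
    (xi : nat -> 'I_n -> {RV P >-> Xi})
    (b : nat -> Omega -> {ffun 'I_n -> bool})
    (x0 : 'rV[R]_d) (h0 w0 : 'I_n -> 'rV[R]_d) (k : nat) (t : Omega) :
    diana_state R d n :=
  if k is k'.+1 then
    vr_diana_step Fij r gamma alpha (fun i => j k' i t)
      (fun i y => Q y (xi k' i t)) (b k' t)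
      (vr_diana_sgda Fij r gamma alpha Q j xi b x0 h0 w0 k' t)
  else
    {| st_x := x0; st_h := n%:R^-1 *: \sum_(i < n) h0 i;
       st_hi := h0; st_w := w0 |}.

(* Main.v *)
Require Import Defs.
From HB Require Import structures.
From mathcomp Require Import all_boot all_order all_algebra.
From mathcomp Require Import all_classical all_reals all_analysis measurable_realfun.
From mathcomp Require Import ring lra.
Set Implicit Arguments.
Unset Strict Implicit.
Unset Printing Implicit Defensive.
Import Order.TTheory GRing.Theory Num.Theory.
Import numFieldNormedType.Exports.
Local Open Scope classical_set_scope.
Local Open Scope ring_scope.

(** The iterates are controlled by V = |x - xs|^2 + M sigma^2, where sigma^2 adds
    the mean squared errors of the shifts h_i and of the reference points w_i.

    For a fixed state, the prox is nonexpansive and xs satisfies the optimality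
    condition of the prox at xs - gamma F xs, so only E|x - gamma g - (xs - gamma F xs)|^2
    matters.  The messages Q(g_i - h_i) of distinct workers are uncorrelated with mean
    F_i x - h_i, hence this is |x - xs - gamma (F x - F xs)|^2 plus gamma^2 / n^2
    times the sum of their variances; star-cocoercivity bounds everything by
    <F x - F xs, x - xs> and sigma^2, and M is chosen so that V contracts.

    The state at time k is measurable with respect to the sigma-algebra of the
    samples of times < k, which is independent of that of time k.  The diagonal
    map of Omega into the product of these two measurable spaces thus carries P to
    a product measure, and Tonelli reduces one step of the algorithm to the case of
    a fixed state. *)

(** * Euclidean geometry and the proximal operator *)

(** The existence of the prox rests on the solution itself: the variational inequality at [xs] gives
    the affine minorant [r xs - <F xs, z - xs>] of [r], so the prox objective dominates a strictly
    convex quadratic. Nonexpansiveness then makes the prox continuous, hence Borel, and the iterates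
    become random variables.

    The expectation of V at time k is not known to be finite before the bound is proved. Past and
    present are therefore separated for nonnegative functions with values in [\bar R], whereas from
    a fixed state all the moments involved are finite and the calculus takes place in [R].

    With M = 4 (omega + 1) gamma^2 / (n alpha), half of the contraction [alpha] of the shift errors
    pays for the compression noise, which leaves the rate [alpha / 2]. The errors of the reference
    points then carry the factor [1 - p + 5 alpha / 2], and [alpha <= p / 3] brings it below
    [1 - alpha / 2]. The coins enter V affinely, so its expectation involves them through their
    marginal probability [p]. *)

Section euclidean.
Context (R : realType) (d : nat).
Implicit Types (x y z : 'rV[R]_d) (a : R).

Lemma dotC x y : dot x y = dot y x.
Proof. by apply: eq_bigr => c _; rewrite mulrC. Qed.

Lemma dotDl x y z : dot (x + y) z = dot x z + dot y z.
Proof. by rewrite -big_split; apply: eq_bigr => c _; rewrite mxE mulrDl. Qed.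

Lemma dotZl a x z : dot (a *: x) z = a * dot x z.
Proof. by rewrite mulr_sumr; apply: eq_bigr => c _; rewrite mxE mulrA. Qed.

Lemma dotNl x z : dot (- x) z = - dot x z.
Proof. by rewrite -scaleN1r dotZl mulN1r. Qed.

Lemma dotBl x y z : dot (x - y) z = dot x z - dot y z.
Proof. by rewrite dotDl dotNl. Qed.

Lemma dotDr x y z : dot z (x + y) = dot z x + dot z y.
Proof. by rewrite dotC dotDl !(dotC z). Qed.

Lemma dotZr a x z : dot z (a *: x) = a * dot z x.
Proof. by rewrite dotC dotZl dotC. Qed.

Lemma dotBr x y z : dot z (x - y) = dot z x - dot z y.
Proof. by rewrite dotC dotBl !(dotC z). Qed.

Lemma dot_ge0 x : 0 <= dot x x.
Proof. by apply: sumr_ge0 => c _; rewrite -expr2 sqr_ge0. Qed.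

Lemma enorm_sq x : enorm x ^+ 2 = dot x x.
Proof. by rewrite sqr_sqrtr// dot_ge0. Qed.

Lemma enorm_sqE x : enorm x ^+ 2 = \sum_(c < d) x ord0 c ^+ 2.
Proof. by rewrite enorm_sq; apply: eq_bigr => c _; rewrite expr2. Qed.

Lemma enorm_ge0 x : 0 <= enorm x.
Proof. exact: sqrtr_ge0. Qed.

Lemma coord_le_enorm x c : x ord0 c ^+ 2 <= enorm x ^+ 2.
Proof.
by rewrite enorm_sqE (bigD1 c)//= lerDl sumr_ge0// => *; exact: sqr_ge0.
Qed.

(* Young: 2<x,y> <= |x|^2 + |y|^2, whence firm nonexpansiveness gives
   nonexpansiveness. *)
Lemma dot_le_enorm x y : enorm y ^+ 2 <= dot x y -> enorm y ^+ 2 <= enorm x ^+ 2.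
Proof.
move=> h; have := dot_ge0 (x - y).
rewrite dotBl !dotBr (dotC y x) -!enorm_sq; lra.
Qed.

Lemma metric_proj1 (v x : 'rV[R]_d) : metric_proj [set v] x = v.
Proof.
have /xgetPex : exists z, argmin (fun y => (enorm (y - x))%:E) [set v] z.
  by exists v; split => // _ ->.
by move=> /(_ 0)[].
Qed.

Lemma enorm_sqB2 x y z :
  enorm (x - y) ^+ 2 <= 2 * enorm (x - z) ^+ 2 + 2 * enorm (y - z) ^+ 2.
Proof.
rewrite !enorm_sqE !mulr_sumr -big_split/=; apply: ler_sum => c _.
rewrite !mxE; set a := x _ _; set b := y _ _; set e := z _ _.
have := sqr_ge0 ((a - e) + (b - e)); nra.
Qed.

End euclidean.

Section prox.
Context (R : realType) (d : nat) (r : 'rV[R]_d -> \bar R).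
Hypothesis r_proper : proper_efun r.
Variables (gamma : R) (gamma_gt0 : 0 < gamma).

(** The inclusion of [(x - y) / gamma] in the subdifferential of [r] at [y], written out as an
    inequality; finiteness of [r y] allows two such inequalities to be added in the reals. *)
Definition prox_optimality (x y : 'rV[R]_d) : Prop :=
  r y \is a fin_num /\
  forall z, (r y + (dot (x - y) (z - y) / gamma)%R%:E <= r z)%E.

(** Testing each condition at the other point and adding cancels the values of [r]; what remains is
    firm nonexpansiveness. *)
Lemma prox_optimality_nonexpansive x1 x2 y1 y2 :
  prox_optimality x1 y1 -> prox_optimality x2 y2 ->
  enorm (y1 - y2) ^+ 2 <= enorm (x1 - x2) ^+ 2.
Proof.
move=> [f1 h1] [f2 h2]; apply: dot_le_enorm.
have := h1 y2; have := h2 y1.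
rewrite -(fineK f1) -(fineK f2) -!EFinD !lee_fin.
set a := fine _; set b := fine _ => u v.
have : dot (x1 - y1) (y2 - y1) / gamma + dot (x2 - y2) (y1 - y2) / gamma <= 0.
  lra.
rewrite -mulrDl pmulr_lle0 ?invr_gt0// enorm_sq.
rewrite !dotBl !dotBr; lra.
Qed.

Lemma argmin_prox_optimality (r_convex : econvex r) x y :
  argmin (fun y => r y + (enorm (y - x) ^+ 2 / (2 * gamma))%R%:E)%E setT y ->
  prox_optimality x y.
Proof.
move=> [_ ymin].
have [rN [z0 rz0]] := r_proper.
have fy : r y \is a fin_num.
  have := ymin z0 I; rewrite fin_numE rN/=.
  move: rz0 (rN z0); case: (r z0) => [a| |]//= _ _.
  by case: (r y) => [b| |].
split => // z.
have [->|rzoo] := eqVneq (r z) +oo%E; first by rewrite leey.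
have fz : r z \is a fin_num by rewrite fin_numE rN.
rewrite -(fineK fy) -(fineK fz) -EFinD lee_fin.
set a := fine (r y); set b := fine (r z).
set u := dot _ _; set v := enorm (z - y) ^+ 2.
(* compare y with y + t (z - y) and let t tend to 0 *)
have key t : 0 < t < 1 -> a + u / gamma <= b + t * v / (2 * gamma).
  move=> /andP[t0 t1].
  have := ymin (t *: z + (1 - t) *: y) I.
  have /= := @r_convex z y t; rewrite t0 t1 => /(_ isT).
  rewrite -(fineK fy) -(fineK fz) -/a -/b -!EFinM -!EFinD.
  have : r (t *: z + (1 - t) *: y) != -oo%E by [].
  case: (r _) => [c| |]//= _; rewrite -!EFinD !lee_fin => h1 h2.
  move: (h2); rewrite !enorm_sq.
  have -> : t *: z + (1 - t) *: y - x = (y - x) + t *: (z - y).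
    by apply/rowP => i; rewrite !mxE; ring.
  have -> : dot (y - x + t *: (z - y)) (y - x + t *: (z - y)) =
      dot (y - x) (y - x) + (2 * t * - u + t * (t * v)).
    rewrite /u /v enorm_sq -(opprB y x) dotNl; move: (y - x) (z - y) => p q.
    by rewrite !(dotDl, dotDr, dotZl, dotZr) (dotC q p); ring.
  set w := dot _ _ => h3.
  have h4 : a + w / (2 * gamma) <=
     (t * b + (1 - t) * a) + (w + (2 * t * - u + t * (t * v))) / (2 * gamma).
    by apply: (le_trans h3); rewrite lerD2r.
  have {h4} h5 : 0 <= t * (b + t * v / (2 * gamma) - a - u / gamma).
    move: h4; rewrite -subr_ge0; congr (_ <= _); field.
    by rewrite gt_eqF.
  by move: h5; rewrite pmulr_rge0//; lra.
rewrite leNgt; apply/negP => lt.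
pose e := a + u / gamma - b.
have e0 : 0 < e by rewrite /e; lra.
have v0 : 0 <= v by rewrite /v sqr_ge0.
(* This denominator gives both [t < 1] and [t * v <= e * gamma], so that the second-order term is at
   most [e / 2], while [key] bounds it below by [e]. *)
pose t := e * gamma / (v + e * gamma + 1).
have eg : 0 < e * gamma by rewrite mulr_gt0.
have t01 : 0 < t < 1.
  rewrite /t divr_gt0//=; last lra.
  by rewrite ltr_pdivrMr; lra.
have := key t t01.
have : t * v / (2 * gamma) < e.
  rewrite ltr_pdivrMr ?mulr_gt0//.
  have : t * v <= e * gamma.
    rewrite /t mulrAC ler_pdivrMr; last lra.
    by rewrite ler_pM2l//; lra.
  lra.
rewrite /e; lra.
Qed.

(** If the infimum [m] is not attained, the traces on [K] of the sublevel sets of levels above [m]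
    generate a proper filter. At a cluster point [y], lower semicontinuity keeps [f] above some
    level between [m] and [f y] on a neighborhood, which thus misses a set of the filter. *)
Lemma argmin_compact (T : topologicalType) (f : T -> \bar R) (K : set T) :
  compact K -> K !=set0 -> lower_semicontinuous f ->
  exists y, argmin f K y.
Proof.
move=> cK [y0 Ky0] lscf.
pose m := ereal_inf (f @` K).
have [[y Ky fy]|nattained] := pselect (exists2 y, K y & (f y <= m)%E).
  exists y; split => // z Kz; apply: (le_trans fy).
  by apply: ereal_inf_lbound; exists z.
exfalso.
have lt y : K y -> (m < f y)%E.
  by move=> Ky; rewrite ltNge; apply/negP => fy; apply: nattained; exists y.
have Fx : forall a, (m < a)%E -> exists2 y, K y & (f y <= a)%E.
  move=> a ma; have [_ [y Ky <-] fya] := ereal_inf_lt ma.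
  by exists y => //; exact: ltW.
pose G := filter_from [set a : \bar R | (m < a)%E]
  (fun a => K `&` [set y | (f y <= a)%E]).
have pG : ProperFilter G.
  apply: filter_from_proper; last first.
    by move=> a /Fx[y Ky ya]; exists y.
  apply: filter_from_filter.
    by exists (f y0); exact: lt.
  move=> a b ma mb; exists (Order.min a b).
    by rewrite /= lt_min ma mb.
  by move=> y [Ky]/=; rewrite le_min => /andP[ya yb].
have GK : G K by exists (f y0); [exact: lt|move=> y []].
have [y [Ky cly]] := cK G pG GK.
have /= := lt y Ky.
(* Lower semicontinuity is stated for real levels, so a real number has to be inserted also when [m]
   or [f y] is infinite. *)
have : exists2 a : R, (m < a%:E)%E & (a%:E < f y)%E.
  have := lt y Ky; case: (m) => [m'| |]; case: (f y) => [b| |] //=.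
  - rewrite lte_fin => mb; exists ((m' + b) / 2); rewrite lte_fin; lra.
  - by move=> _; exists (m' + 1); rewrite ?ltry// lte_fin; lra.
  - by move=> _; exists (b - 1); rewrite ?ltNyr// lte_fin; lra.
  - by move=> _; exists 0; rewrite ?ltry ?ltNyr.
move=> [a ma ay] _.
have [V nV Va] := lscf y a ay.
have Ga : G (K `&` [set z | (f z <= a%:E)%E]) by exists a%:E.
have [z [[_ /= fz] Vz]] := cly _ _ Ga nV.
by have := lt_le_trans (Va z Vz) fz; rewrite ltxx.
Qed.

End prox.

Lemma sqdist_continuous (R : realType) (d : nat) (x : 'rV[R]_d) :
  continuous (fun y : 'rV[R]_d => enorm (y - x) ^+ 2).
Proof.
have -> : (fun y => enorm (y - x) ^+ 2) =
    (fun y : 'rV[R]_d => \sum_(c < d) (y ord0 c - x ord0 c) * (y ord0 c - x ord0 c)).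
  by apply/funext => y; rewrite enorm_sq; apply: eq_bigr => c _; rewrite !mxE.
apply: (@continuous_big _ _ +%R) => [a|c _ y].
  exact: add_continuous.
have h : z ord0 c - x ord0 c @[z --> (y : 'rV[R]_d)] --> y ord0 c - x ord0 c.
  by apply: cvgB; [exact: coord_continuous|exact: cvg_cst].
exact: (cvgM h h).
Qed.

(** A level [a] below the sum splits as [b + (a - b)] with [b] below [f x] and [a - b] below [g x];
    each inequality persists on a neighborhood of its own. *)
Lemma lower_semicontinuousD (R : realType) (T : topologicalType)
  (f : T -> \bar R) (g : T -> R) :
  (forall x, f x != -oo%E) -> lower_semicontinuous f -> continuous g ->
  lower_semicontinuous (fun x => f x + (g x)%:E)%E.
Proof.
move=> fN lscf cg x a fga.
have [b ab bf] : exists2 b : R, a - b < g x & (b%:E < f x)%E.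
  move: fga (fN x); case: (f x) => [s| |]//.
    rewrite -EFinD lte_fin => h _.
    exists ((a - g x + s) / 2); rewrite ?lte_fin; lra.
  by move=> _ _; exists (a - g x + 1); rewrite ?ltry//; lra.
have [V nV Vb] := lscf x b bf.
have nW : nbhs x [set y | a - b < g y].
  have /(_ [set s | a - b < s]) := cg x; apply.
  by exists (g x - (a - b)); [rewrite /=; lra|move=> s /=; rewrite ltr_distlC; lra].
exists (V `&` [set y | a - b < g y]); first exact: filterI.
move=> y [/Vb by_ /= aby].
have -> : a%:E = (b%:E + (a - b)%:E)%E by rewrite -EFinD; congr EFin; ring.
by rewrite lteD// lte_fin.
Qed.

Section prox_existence.
Context (R : realType) (d : nat) (r : 'rV[R]_d -> \bar R).
Hypotheses (r_proper : proper_efun r) (r_lsc : lower_semicontinuous r)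
  (r_convex : econvex r).
Variables (xs v : 'rV[R]_d).
Hypothesis r_xs : r xs \is a fin_num.
Hypothesis r_minorant : forall z, (r xs - (dot v (z - xs))%R%:E <= r z)%E.
Variables (gamma : R) (gamma_gt0 : 0 < gamma).

(** The quadratic obtained from the minorant of [r] lies below the objective and agrees with it at
    [xs]. Outside the box [K] centered at its minimizer [u], with half-width the distance from [u]
    to [xs], it is at least its value at [xs]; hence a minimizer over the compact [K], which
    contains [xs], is a global one. *)
Lemma prox_argmin x :
  argmin (fun y => r y + (enorm (y - x) ^+ 2 / (2 * gamma))%R%:E)%E setT
    (prox gamma r x).
Proof.
suff : exists y, argmin (fun y => r y + (enorm (y - x) ^+ 2 / (2 * gamma))%R%:E)%E setT y.
  by move=> /(xgetPex 0).
pose f (y : 'rV[R]_d) := (r y + (enorm (y - x) ^+ 2 / (2 * gamma))%R%:E)%E.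
(* u is the minimizer of the quadratic minorant of f given by r_minorant *)
have [u uE] : exists u, u = x + gamma *: v by eexists.
pose K : set 'rV[R]_d :=
  [set y : 'rV[R]_d | forall c,
    `[u ord0 c - enorm (xs - u), u ord0 c + enorm (xs - u)]%classic (y ord0 c)].
have cK : compact K.
  apply: (rV_compact (A := fun c => `[u ord0 c - enorm (xs - u),
    u ord0 c + enorm (xs - u)]%classic)) => c; exact: segment_compact.
have Kxs : K xs.
  move=> c; rewrite /= in_itv/=.
  have := coord_le_enorm (xs - u) c; rewrite -ler_sqrt ?sqr_ge0//.
  rewrite !sqrtr_sqr (ger0_norm (enorm_ge0 _)) !mxE ler_norml.
  by move=> /andP[? ?]; apply/andP; split; lra.
have lscf : lower_semicontinuous f.
  apply: lower_semicontinuousD => //; first by have [] := r_proper.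
  move=> y; have h : enorm (z - x) ^+ 2 @[z --> (y : 'rV[R]_d)] -->
      enorm (y - x) ^+ 2 by exact: sqdist_continuous.
  exact: (cvgMr_tmp h).
have [y [Ky ymin]] := argmin_compact cK (ex_intro _ _ Kxs) lscf.
exists y; split => // z _.
have [Kz|nKz] := pselect (K z); first exact: ymin.
apply: (le_trans (ymin _ Kxs)).
rewrite /f; apply: le_trans; last by apply: leeD; [exact: r_minorant|exact: lexx].
rewrite -(fineK r_xs) -EFinN -!EFinD lee_fin.
have : enorm (xs - u) ^+ 2 <= enorm (z - u) ^+ 2.
  have /existsNP[c] := nKz; rewrite /= in_itv/= => /negP h.
  apply: le_trans (coord_le_enorm _ c).
  rewrite -ler_sqrt ?sqr_ge0// !sqrtr_sqr (ger0_norm (enorm_ge0 _)) !mxE.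
  rewrite leNgt; apply: contra h => h; move: h; rewrite ltr_norml => /andP[h1 h2].
  by apply/andP; split; lra.
have -> : enorm (xs - x) ^+ 2 = enorm (xs - u) ^+ 2 + 2 * gamma * dot v (xs - u)
    + gamma ^+ 2 * dot v v.
  have -> : xs - x = (xs - u) + gamma *: v by rewrite uE opprD -addrA subrK.
  rewrite !enorm_sq; move: (xs - u) => q.
  by rewrite !(dotDl, dotDr, dotZl, dotZr) (dotC q); ring.
have -> : enorm (z - x) ^+ 2 = enorm (z - u) ^+ 2 + 2 * gamma * dot v (z - u)
    + gamma ^+ 2 * dot v v.
  have -> : z - x = (z - u) + gamma *: v by rewrite uE opprD -addrA subrK.
  rewrite !enorm_sq; move: (z - u) => q.
  by rewrite !(dotDl, dotDr, dotZl, dotZr) (dotC q); ring.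
have -> : z - xs = (z - u) - (xs - u) by rewrite opprB addrA subrK.
rewrite (dotBr (z - u)) => h; rewrite -subr_ge0.
set A := enorm (z - u) ^+ 2 in h *; set B := enorm (xs - u) ^+ 2 in h *.
set s := fine _; set a := dot v (z - u); set b := dot v (xs - u); set e := dot v v.
suff -> : s - (a - b) + (A + 2 * gamma * a + gamma ^+ 2 * e) / (2 * gamma) -
    (s + (B + 2 * gamma * b + gamma ^+ 2 * e) / (2 * gamma)) = (A - B) / (2 * gamma).
  by rewrite divr_ge0 ?subr_ge0// mulr_ge0// ltW.
by field; rewrite gt_eqF.
Qed.

Lemma proxP x : prox_optimality r gamma x (prox gamma r x).
Proof. by apply: argmin_prox_optimality => //; exact: prox_argmin. Qed.

Lemma prox_nonexpansive x1 x2 :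
  enorm (prox gamma r x1 - prox gamma r x2) ^+ 2 <= enorm (x1 - x2) ^+ 2.
Proof.
by apply: (prox_optimality_nonexpansive gamma_gt0); exact: proxP.
Qed.

Lemma prox_dist_solution x :
  enorm (prox gamma r x - xs) ^+ 2 <= enorm (x - (xs - gamma *: v)) ^+ 2.
Proof.
apply: (prox_optimality_nonexpansive gamma_gt0); first exact: proxP.
split => // z; rewrite (addrC xs) addrK.
have -> : dot (- (gamma *: v)) (z - xs) / gamma = - dot v (z - xs).
  by rewrite dotNl dotZl; field; rewrite gt_eqF.
by rewrite EFinN; exact: r_minorant.
Qed.

End prox_existence.

(** * Measurability of vector-valued maps *)

Section borel.
Context (R : realType) (d : nat) (dT : measure_display) (T : measurableType dT).
Implicit Types f g : T -> 'rV[R]_d.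

Definition bmeasurable f := measurable_fun [set: T] (f : T -> borel R d).

Lemma bmeasurable_coord f c : bmeasurable f ->
  measurable_fun [set: T] (fun t => f t ord0 c).
Proof.
move=> mf; apply: (measurability _ (RGenOpens.measurableE R)) => _ [_ [a [b ->]] <-].
rewrite setTI; set U := (X in _ @^-1` X).
have oU : open U by exact: interval_open.
have oV : open [set v : 'rV[R]_d | U (v ord0 c)].
  apply: open_comp => // v _; exact: coord_continuous.
have := mf measurableT [set v | U (v ord0 c)].
by rewrite setTI; apply; exact: sub_sigma_algebra.
Qed.

(** An open set is the union of the countably many boxes with rational center and radius that it
    contains, and the preimage of a box is a finite intersection of conditions on coordinates. *)
Lemma bmeasurableP f : bmeasurable f <->
  forall c, measurable_fun [set: T] (fun t => f t ord0 c).
Proof.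
split=> [mf c|mf]; first exact: bmeasurable_coord.
apply: measurability => // _ [U oU <-]; rewrite setTI.
pose B (q : 'rV[rat]_d * rat) : set 'rV[R]_d :=
  [set v | forall c, `|ratr (q.1 ord0 c) - v ord0 c| < ratr q.2].
have -> : f @^-1` U = \bigcup_(q in [set q | B q `<=` U]) (f @^-1` B q).
  apply/seteqP; split=> [t /= Uft|t [q /= qU]]; last exact: qU.
  have [e /= e0 eU] : exists2 e : R, 0 < e & ball (f t) e `<=` U.
    by apply/nbhs_ballP; exact: open_nbhs_nbhs.
  (* A box of rational radius [s < e / 2] whose center is within [s] of [f t] contains [f t] and, as
     [2 s < e], stays in the ball of radius [e]. *)
  have [s /= ] := @rat_in_itvoo R 0 (e / 2) ltac:(lra).
  rewrite in_itv/= => /andP[s0 se].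
  have /choice[w hw] : forall c, exists w : rat,
      ratr w \in `]f t ord0 c, (f t ord0 c + ratr s)[.
    by move=> c; apply: rat_in_itvoo; lra.
  exists (\row_c w c, s).
    move=> v /= vB; apply: eU; split => // i c; rewrite (ord1 i).
    have := vB c; have := hw c; rewrite mxE in_itv/= /ball/= => /andP[h1 h2].
    by rewrite !ltr_norml => /andP[h3 h4]; apply/andP; split; lra.
  move=> c /=; have := hw c; rewrite mxE in_itv/= ltr_norml => /andP[h1 h2].
  by apply/andP; split; lra.
rewrite bigcup_mkcond; apply: countable_bigcupT_measurable => [|q].
  exact: countableP.
case: ifP => // _.
rewrite [X in measurable X](_ : _ = \bigcap_(c in [set: 'I_d])
    ((fun t => f t ord0 c) @^-1` [set s | `|ratr (q.1 ord0 c) - s| < ratr q.2])).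
  apply: fin_bigcap_measurable => // c _; rewrite -[X in measurable X]setTI.
  apply: mf => //; apply: open_measurable.
  rewrite (_ : [set s | _] = ball (ratr (q.1 ord0 c) : R) (ratr q.2))//.
  exact: ball_open.
by apply/seteqP; split=> [t /= h c _|t /= h c]; exact: h.
Qed.

Lemma bmeasurable_cst v : bmeasurable (fun=> v).
Proof. by apply/bmeasurableP => c; exact: measurable_cst. Qed.

Lemma bmeasurableD f g : bmeasurable f -> bmeasurable g ->
  bmeasurable (fun t => f t + g t).
Proof.
move=> /bmeasurableP mf /bmeasurableP mg; apply/bmeasurableP => c.
by under eq_fun do rewrite mxE; exact: measurable_funD.
Qed.

Lemma bmeasurableZ a f : bmeasurable f -> bmeasurable (fun t => a *: f t).
Proof.
move=> /bmeasurableP mf; apply/bmeasurableP => c.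
by under eq_fun do rewrite mxE; exact: measurable_funM.
Qed.

Lemma bmeasurableB f g : bmeasurable f -> bmeasurable g ->
  bmeasurable (fun t => f t - g t).
Proof.
move=> mf mg; under [X in bmeasurable X]eq_fun do rewrite -scaleN1r.
by apply: bmeasurableD => //; exact: bmeasurableZ.
Qed.

Lemma bmeasurable_sum (I : Type) (s : seq I) (F : I -> T -> 'rV[R]_d) :
  (forall i, bmeasurable (F i)) -> bmeasurable (fun t => \sum_(i <- s) F i t).
Proof.
move=> mF; elim: s => [|i s ih].
  by under [X in bmeasurable X]eq_fun do rewrite big_nil; exact: bmeasurable_cst.
by under [X in bmeasurable X]eq_fun do rewrite big_cons; exact: bmeasurableD.
Qed.

Lemma measurable_enorm_sq f : bmeasurable f ->
  measurable_fun [set: T] (fun t => enorm (f t) ^+ 2).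
Proof.
move=> /bmeasurableP mf; under eq_fun do rewrite enorm_sqE.
by apply: measurable_sum => c; exact: measurable_funX.
Qed.

Lemma bmeasurable_comp (G : 'rV[R]_d -> 'rV[R]_d) f :
  measurable_fun [set: borel R d] (G : borel R d -> borel R d) ->
  bmeasurable f -> bmeasurable (G \o f).
Proof. by move=> mG mf; exact: (measurableT_comp mG mf). Qed.

Lemma bmeasurable_if (B : T -> bool) f g : measurable [set t | B t] ->
  bmeasurable f -> bmeasurable g -> bmeasurable (fun t => if B t then f t else g t).
Proof.
move=> mB mf mg; apply: measurable_fun_ifT => //.
apply: (measurable_fun_bool true) => //.
by rewrite setTI (_ : _ @^-1` _ = [set t | B t])//; apply/seteqP; split.
Qed.

(** This handles an operator selected by a random index: the domain splits into the finitely many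
    fibers of [s], and on each of them the map is a single [F i]. *)
Lemma bmeasurable_switch (I : finType) (s : T -> I) (F : I -> T -> 'rV[R]_d) :
  (forall i, measurable (s @^-1` [set i])) -> (forall i, bmeasurable (F i)) ->
  bmeasurable (fun t => F (s t) t).
Proof.
move=> ms mF _ Y mY; rewrite setTI.
rewrite [X in measurable X](_ : _ =
    \bigcup_(i in [set: I]) ((s @^-1` [set i]) `&` (F i @^-1` Y))).
  apply: fin_bigcup_measurable => // i _; apply: measurableI => //.
  by rewrite -[X in measurable X]setTI; exact: mF.
apply/seteqP; split=> [t Yt|t [i _ [<-]]]//.
by exists (s t).
Qed.

End borel.

Lemma enorm_lipschitz_measurable (R : realType) (d : nat)
    (G : 'rV[R]_d -> 'rV[R]_d) :
  (forall x y, enorm (G x - G y) ^+ 2 <= enorm (x - y) ^+ 2) ->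
  measurable_fun [set: borel R d] (G : borel R d -> borel R d).
Proof.
move=> Glip; have cG : continuous G.
  move=> x A /nbhs_ballP[e /= e0 eA].
  (* The Euclidean norm is at most [Num.sqrt d%:R] times the sup norm; the added 1 makes the
     comparison strict and [M] positive even for [d = 0]. *)
  pose M : R := (Num.sqrt d%:R) + 1.
  have M0 : 0 < M by rewrite ltr_wpDl// sqrtr_ge0.
  have eM0 : 0 < e / M by rewrite divr_gt0.
  apply/(nbhs_ballP x); exists (e / M) => //= y [_ xy].
  apply: eA; split => // i c.
  rewrite (ord1 i) /ball/=; rewrite -[ltRHS]ger0_norm ?(ltW e0)//.
  rewrite -!sqrtr_sqr ltr_sqrt ?exprn_gt0//.
  have := coord_le_enorm (G x - G y) c; rewrite !mxE => /le_lt_trans; apply.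
  apply: (le_lt_trans (Glip _ _)); rewrite enorm_sqE.
  have : \sum_(c < d) (x - y) ord0 c ^+ 2 <= \sum_(c < d) (e / M) ^+ 2.
    apply: ler_sum => k _; have := xy ord0 k; rewrite /ball/= !mxE => /ltW.
    rewrite -ler_sqr ?nnegrE//; last by rewrite divr_ge0 ?ltW.
    by rewrite -normrX ger0_norm// sqr_ge0.
  move=> /le_lt_trans; apply.
  rewrite sumr_const card_ord -mulr_natl exprMn mulrCA gtr_pMr ?exprn_gt0//.
  rewrite exprVn ltr_pdivrMr ?exprn_gt0// mul1r /M sqrrD sqr_sqrtr//.
  by rewrite expr1n mulr1 -addrA ltrDl ltr_wpDl// mulrn_wge0// sqrtr_ge0.
apply: measurability => // _ [U oU <-]; rewrite setTI.
apply: sub_sigma_algebra; apply: open_comp => // x _; exact: cG.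
Qed.

(** * Independence *)

Section independent_pair.
Context (R : realType) (dO d1 d2 : measure_display) (Omega : measurableType dO)
  (T1 : measurableType d1) (T2 : measurableType d2) (P : probability Omega R)
  (A : Omega -> T1) (B : Omega -> T2).
Hypotheses (mA : measurable_fun [set: Omega] A)
  (mB : measurable_fun [set: Omega] B).
Hypothesis indepAB : forall C D, measurable C -> measurable D ->
  P ((A @^-1` C) `&` (B @^-1` D)) = (P (A @^-1` C) * P (B @^-1` D))%E.

Let mAB : measurable_fun [set: Omega] (fun t => (A t, B t)).
Proof. exact: measurable_fun_pair. Qed.

Let Arv : {mfun Omega >-> T1} := HB.pack A (isMeasurableFun.Build _ _ _ _ A mA).
Let Brv : {mfun Omega >-> T2} := HB.pack B (isMeasurableFun.Build _ _ _ _ B mB).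
Let ABrv : {mfun Omega >-> (T1 * T2)%type} :=
  HB.pack (fun t => (A t, B t)) (isMeasurableFun.Build _ _ _ _ _ mAB).

Let joint_law (X : set (T1 * T2)) : measurable X ->
  (distribution P Arv \x distribution P Brv)%E X = distribution P ABrv X.
Proof.
by move=> mX; exact: product_measure_unique.
Qed.

Lemma ge0_integral_independent (f : T1 * T2 -> \bar R) :
  measurable_fun [set: T1 * T2] f -> (forall z, 0 <= f z)%E ->
  (\int[P]_t f (A t, B t) = \int[P]_t \int[P]_t' f (A t, B t'))%E.
Proof.
move=> mf f0.
transitivity (\int[distribution P ABrv]_z f z)%E.
  by rewrite ge0_integral_distribution.
transitivity (\int[(distribution P Arv \x distribution P Brv)%E]_z f z)%E.
  by apply: eq_measure_integral => X mX _; exact/esym/joint_law.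
rewrite fubini_tonelli1// ge0_integral_distribution//; last 2 first.
- exact: (measurable_fun_fubini_tonelli_F f).
- by move=> y; exact: integral_ge0.
apply: eq_integral => t _; rewrite /= /fubini_F ge0_integral_distribution//.
exact: measurableT_comp.
Qed.

(** Tonelli applied to the absolute value of the product bounds its integral by the product of two
    finite ones. This gives the integrability under the product law that Fubini requires for the
    signed integral. *)
Lemma expectation_independentM (f : T1 -> R) (g : T2 -> R) :
  measurable_fun [set: T1] f -> measurable_fun [set: T2] g ->
  P.-integrable [set: Omega] (EFin \o (f \o A)) ->
  P.-integrable [set: Omega] (EFin \o (g \o B)) ->
  P.-integrable [set: Omega] (EFin \o (fun t => f (A t) * g (B t))) /\
  ('E_P[fun t => (f (A t) * g (B t))%R] = 'E_P[f \o A] * 'E_P[g \o B])%E.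
Proof.
move=> mf mg intf intg.
pose h (z : T1 * T2) : \bar R := (f z.1 * g z.2)%:E.
have mh : measurable_fun [set: T1 * T2] h.
  by apply/measurable_EFinP; apply: measurable_funM; exact: measurableT_comp.
have hfin : (\int[P]_t `|h (A t, B t)| < +oo)%E.
  rewrite (ge0_integral_independent (f := abse \o h)); last 2 first.
  - exact: measurableT_comp.
  - by move=> z; exact: abse_ge0.
  have /integrableP[_ ffin] := intf; have /integrableP[_ gfin] := intg.
  rewrite [ltLHS](_ : _ = (\int[P]_t `|(EFin \o (f \o A)) t|) *
      (\int[P]_t `|(EFin \o (g \o B)) t|))%E; last first.
    rewrite -ge0_integralZr//; last 2 first.
    - apply: measurableT_comp => //.
      exact: measurable_int intf.
    - exact: integral_ge0.
    apply: eq_integral => t _ /=; rewrite -ge0_integralZl//; last first.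
      apply: measurableT_comp => //.
      apply: measurableT_comp => //; exact: (measurableT_comp mg mB).
    by apply: eq_integral => t' _; rewrite /= normrM EFinM.
  by rewrite lte_mul_pinfty// ?integral_ge0// ge0_fin_numE// integral_ge0.
have inth : P.-integrable [set: Omega] (h \o (fun t => (A t, B t))).
  by apply/integrableP; split => //; exact: measurableT_comp.
split; first exact: inth.
rewrite unlock.
transitivity (\int[distribution P ABrv]_z h z)%E.
  by rewrite integral_distribution.
transitivity (\int[(distribution P Arv \x distribution P Brv)%E]_z h z)%E.
  by apply: eq_measure_integral => X mX _; exact/esym/joint_law.
have inth' : (distribution P Arv \x distribution P Brv)%E.-integrable
    [set: T1 * T2] h.
  apply/integrableP; split => //.
  rewrite (eq_measure_integral (distribution P ABrv)); last first.
    by move=> X mX _; exact: joint_law.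
  rewrite ge0_integral_distribution//; exact: measurableT_comp.
have gE : (\int[P]_x ((g \o B) x)%:E)%E \is a fin_num.
  exact: integrable_fin_num.
have FE x : fubini_F (distribution P Brv) h x =
    ((f x)%:E * \int[P]_t ((g \o B) t)%:E)%E.
  rewrite /fubini_F integral_distribution//=.
  - by rewrite -integralZl.
  - exact: measurableT_comp.
  - have := integrableZl measurableT (f x) intg.
    by apply: eq_integrable => // t' _; rewrite /= EFinM.
have intF : P.-integrable [set: Omega] (fubini_F (distribution P Brv) h \o A).
  have := integrableZr measurableT (fine (\int[P]_x ((g \o B) x)%:E)%E) intf.
  by apply: eq_integrable => // t _; rewrite /= FE fineK.
rewrite -integral12_prod_meas1// integral_distribution//; last first.
  exact: (measurable_fubini_F inth').
rewrite -(fineK gE) -integralZr//.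
by apply: eq_integral => t _; rewrite /= FE fineK.
Qed.

End independent_pair.

Section independent_families.
Context (R : realType) (dO : measure_display) (Omega : measurableType dO)
  (P : probability Omega R) (I : eqType) (E : I -> set (set Omega)).
Hypotheses (E_indep : mutually_independent P E)
  (E_measurable : forall l, E l `<=` measurable)
  (E_setT : forall l, E l setT) (E_setI : forall l, setI_closed (E l)).

(* The pi-system generated by the sigma-algebras E l, l \in L. *)
Definition joint_events (L : seq I) : set (set Omega) :=
  [set B | exists2 A : I -> set Omega, (forall l, l \in L -> E l (A l)) &
    B = \bigcap_(l in [set` L]) A l].

Lemma joint_events_setI L : setI_closed (joint_events L).
Proof.
move=> _ _ [A hA ->] [B hB ->]; exists (fun l => A l `&` B l).
  by move=> l lL; apply: E_setI; [exact: hA|exact: hB].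
by rewrite -bigcapI.
Qed.

Lemma joint_events_setT L : joint_events L setT.
Proof.
exists (fun=> setT); first by move=> l _; exact: E_setT.
by rewrite bigcapT.
Qed.

Lemma joint_events_measurable L : joint_events L `<=` measurable.
Proof.
move=> _ [A hA ->]; apply: fin_bigcap_measurable; first exact: finite_seq.
by move=> l /= lL; apply: E_measurable; exact: hA.
Qed.

Lemma sub_joint_events L l : l \in L -> E l `<=` joint_events L.
Proof.
move=> lL B EB; exists (fun l' => if l' == l then B else setT).
  by move=> l' _; case: eqP => [->|_]; [|exact: E_setT].
apply/seteqP; split=> [t Bt l' _|t /(_ l lL)]; last by rewrite /= eqxx.
by case: eqP.
Qed.

Definition sigma_of (L : seq I) := g_sigma_algebraType (joint_events L).

Lemma measurable_sigma_of L : measurable_fun [set: Omega] (id : Omega -> sigma_of L).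
Proof.
apply: measurability => // _ [B hB <-].
rewrite setTI; exact: (joint_events_measurable hB).
Qed.

(** For fixed [B], the measures [P (A & B)] and [P B * P A] of [A] are finite and agree on the
    pi-system [G], hence on the sigma-algebra that it generates. *)
Let indep_extend (G : set (set Omega)) (B : set Omega) : measurable B ->
  G `<=` measurable -> setI_closed G -> G setT ->
  (forall A, G A -> P (A `&` B) = (P A * P B)%E) ->
  forall A, <<s G >> A -> P (A `&` B) = (P A * P B)%E.
Proof.
move=> mB Gm GI GT GB A sA.
have PB0 : 0 <= fine (P B) by rewrite fine_ge0.
have PBE : P B = (fine (P B))%:E by rewrite fineK// fin_num_measure.
suff : mrestr P mB A = mscale (NngNum PB0) P A.
  by rewrite /mrestr /mscale/= -PBE muleC.
apply: (g_sigma_algebra_measure_unique G Gm (fun=> setT)) sA => //.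
- by apply/seteqP; split => // t _; exists 0%N.
- move=> C GC; change (P (C `&` B) = ((fine (P B))%:E * P C)%E).
  by rewrite -PBE GB// muleC.
- move=> _; change (P (setT `&` B) < +oo)%E.
  by rewrite setTI -ge0_fin_numE// fin_num_measure.
Qed.

(** The product formula is extended from the pi-systems to the sigma-algebras one side at a time. On
    the pi-systems the two choices of events glue into a single family [A12] over [L1 ++ L2],
    because the lists are disjoint, and mutual independence applies to it. *)
Lemma independent_sigma_of L1 L2 : uniq (L1 ++ L2) ->
  forall (A : set (sigma_of L1)) (B : set (sigma_of L2)),
  measurable A -> measurable B ->
  P ((A : set Omega) `&` B) = (P (A : set Omega) * P (B : set Omega))%E.
Proof.
rewrite cat_uniq => /and3P[u1 /hasPn u12 u2] A B mA mB.
have toO L (C : set (sigma_of L)) : measurable C -> measurable (C : set Omega).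
  by move=> mC; have := @measurable_sigma_of L measurableT C mC; rewrite setTI.
apply: (@indep_extend (joint_events L1)) => //.
- exact: toO.
- exact: joint_events_measurable.
- exact: joint_events_setI.
- exact: joint_events_setT.
move=> C LC; rewrite setIC muleC.
apply: (@indep_extend (joint_events L2)) => //.
- exact: (joint_events_measurable LC).
- exact: joint_events_measurable.
- exact: joint_events_setI.
- exact: joint_events_setT.
case: LC => A1 hA1 -> _ [A2 hA2 ->].
pose A12 l := if l \in L1 then A1 l else A2 l.
have e1 : \bigcap_(l in [set` L1]) A1 l = \bigcap_(l in [set` L1]) A12 l.
  by apply: eq_bigcapr => l /= lL; rewrite /A12 lL.
have n1 l : l \in L2 -> (l \in L1) = false.
  by move=> lL; apply/negbTE; exact: u12.
have e2 : \bigcap_(l in [set` L2]) A2 l = \bigcap_(l in [set` L2]) A12 l.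
  by apply: eq_bigcapr => l /= lL; rewrite /A12 n1.
have h1 l : l \in L1 -> E l (A12 l) by move=> lL; rewrite /A12 lL; exact: hA1.
have h2 l : l \in L2 -> E l (A12 l) by move=> lL; rewrite /A12 n1//; exact: hA2.
have -> : \bigcap_(l in [set` L2]) A2 l `&` \bigcap_(l in [set` L1]) A1 l =
    \bigcap_(l in [set` L1 ++ L2]) A12 l.
  rewrite e1 e2; apply/seteqP; split => [t [t2 t1] l /=|t h].
    by rewrite mem_cat => /orP[]; [exact: t1|exact: t2].
  by split => l /= lL; apply: h; rewrite /= mem_cat lL ?orbT.
rewrite E_indep; last 2 first.
- by rewrite cat_uniq u1 u2 andbT; apply/hasPn.
- by move=> l; rewrite mem_cat => /orP[]; [exact: h1|exact: h2].
by rewrite big_cat/= e1 e2 !E_indep// muleC.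
Qed.

Lemma measurable_sigma_ofP d' (T' : measurableType d') L l (f : Omega -> T') :
  l \in L -> (forall B, measurable B -> E l (f @^-1` B)) ->
  measurable_fun [set: sigma_of L] (f : sigma_of L -> T').
Proof.
move=> lL hf _ B mB; rewrite setTI; apply: sub_sigma_algebra.
by apply: (sub_joint_events lL); exact: hf.
Qed.

End independent_families.

(** * Measurability of one step of the algorithm *)

Section step_measurable.
Context (R : realType) (d n m : nat) (dX : measure_display)
  (Xi : measurableType dX).
Variables (Fij : 'I_n -> 'I_m -> 'rV[R]_d -> 'rV[R]_d) (r : 'rV[R]_d -> \bar R)
  (gamma alpha : R) (Q : 'rV[R]_d -> Xi -> 'rV[R]_d).
Hypothesis mFij : forall i j,
  measurable_fun [set: borel R d] (Fij i j : borel R d -> borel R d).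
Hypothesis mQ : measurable_fun [set: borel R d * Xi]
  (fun u : borel R d * Xi => Q u.1 u.2 : borel R d).
Hypothesis mprox :
  measurable_fun [set: borel R d] (prox gamma r : borel R d -> borel R d).
Context (dT : measure_display) (T : measurableType dT).

Definition state_measurable (S : T -> diana_state R d n) : Prop :=
  [/\ bmeasurable (fun t => st_x (S t)), bmeasurable (fun t => st_h (S t)),
      forall i, bmeasurable (fun t => st_hi (S t) i) &
      forall i, bmeasurable (fun t => st_w (S t) i)].

(** The space [T] is left general since the step is considered over several spaces: [Omega] with a
    constant state, the sigma-algebra of a list of samples, and the product of past and present. *)
Lemma state_measurable_step (S : T -> diana_state R d n)
    (jr : T -> 'I_n -> 'I_m) (zr : T -> 'I_n -> Xi) (br : T -> 'I_n -> bool) :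
  state_measurable S ->
  (forall i a, measurable ((fun t => jr t i) @^-1` [set a])) ->
  (forall i, measurable_fun [set: T] (fun t => zr t i)) ->
  (forall i, measurable [set t | br t i]) ->
  state_measurable (fun t => vr_diana_step Fij r gamma alpha (jr t)
    (fun i y => Q y (zr t i)) (br t) (S t)).
Proof.
move=> [mx mh mhi mw] mj mz mb.
pose q i t := Q (Fij i (jr t i) (st_x (S t)) - Fij i (jr t i) (st_w (S t) i) +
  mean_op (Fij i) (st_w (S t) i) - st_hi (S t) i) (zr t i).
have mq i : bmeasurable (q i).
  pose y t := Fij i (jr t i) (st_x (S t)) - Fij i (jr t i) (st_w (S t) i) +
    mean_op (Fij i) (st_w (S t) i) - st_hi (S t) i.
  have my : bmeasurable y.
    apply: bmeasurableB => //; apply: bmeasurableD; last first.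
      apply: bmeasurableZ; apply: bmeasurable_sum => a.
      exact: (bmeasurable_comp (mFij i a) (mw i)).
    apply: bmeasurableB; apply: (bmeasurable_switch (F := fun a t => Fij i a _)) => // a.
      exact: (bmeasurable_comp (mFij i a) mx).
    exact: (bmeasurable_comp (mFij i a) (mw i)).
  have myz : measurable_fun [set: T] (fun t => (y t, zr t i) : borel R d * Xi).
    exact: measurable_fun_pair.
  exact: (measurableT_comp mQ myz).
have msq c : bmeasurable (fun t => c *: \sum_(i < n) q i t).
  by apply: bmeasurableZ; exact: bmeasurable_sum.
split=> /=.
- apply: (bmeasurable_comp (G := prox gamma r) mprox).
  apply: bmeasurableB => //; apply: bmeasurableZ; exact: bmeasurableD.
- exact: bmeasurableD.
- by move=> i; apply: bmeasurableD => //; exact: (bmeasurableZ alpha (mq i)).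
- by move=> i; exact: bmeasurable_if.
Qed.

End step_measurable.

(** * Moments of the samples and of the messages *)

Section has_expectation.
Context (R : realType) (dO : measure_display) (Omega : measurableType dO)
  (P : probability Omega R).
Implicit Types (f g : Omega -> R) (a b : R).

(** Integrability and the real value of the expectation are carried together, so that the linear
    rules below compose without side conditions. *)
Definition has_expectation f a : Prop :=
  P.-integrable [set: Omega] (EFin \o f) /\ ('E_P[f] = a%:E)%E.

Lemma has_expectation_cst a : has_expectation (fun=> a) a.
Proof.
split; last by rewrite expectation_cst.
apply/Lfun1_integrable; exact: Lfun_cst.
Qed.

Lemma has_expectationD f g a b : has_expectation f a -> has_expectation g b ->
  has_expectation (fun t => f t + g t) (a + b).
Proof.
move=> [/Lfun1_integrable intf ef] [/Lfun1_integrable intg eg]; split.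
  by apply/Lfun1_integrable; exact: rpredD.
by have := expectationD intf intg; rewrite ef eg.
Qed.

Lemma has_expectationZ c f a : has_expectation f a ->
  has_expectation (fun t => c * f t) (c * a).
Proof.
move=> [intf ef]; split.
  have := integrableZl measurableT c intf.
  by apply: eq_integrable => // t _; rewrite /= EFinM.
move: ef; rewrite unlock => ef.
under eq_integral do rewrite EFinM.
by rewrite integralZl// ef.
Qed.

Lemma has_expectation_sum (I : Type) (s : seq I) (f : I -> Omega -> R) (a : I -> R) :
  (forall i, has_expectation (f i) (a i)) ->
  has_expectation (fun t => \sum_(i <- s) f i t) (\sum_(i <- s) a i).
Proof.
move=> hf; elim: s => [|i s ih].
  rewrite big_nil; under [X in has_expectation X]eq_fun do rewrite big_nil.
  exact: has_expectation_cst.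
rewrite big_cons; under [X in has_expectation X]eq_fun do rewrite big_cons.
exact: has_expectationD.
Qed.

Lemma eq_has_expectation f g a : f =1 g -> has_expectation f a ->
  has_expectation g a.
Proof. by move=> /funext ->. Qed.

Lemma has_expectation_unique f a b : has_expectation f a ->
  has_expectation f b -> a = b.
Proof. by move=> [_ fa] [_]; rewrite fa => -[]. Qed.

Lemma has_expectation_indic (B : Omega -> bool) a : measurable [set t | B t] ->
  P [set t | B t] = a%:E -> has_expectation (fun t => (B t)%:R) a.
Proof.
move=> mB PB.
have -> : (fun t => (B t)%:R) = \1_[set t | B t] :> (Omega -> R).
  by apply/funext => t; rewrite indicE mem_setE.
split; last by rewrite expectation_indic.
exact: integrable_indic.
Qed.

(** A real bound on the expectation of a nonnegative function already yields integrability. The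
    variance bound on the compressor, an inequality in [\bar R], enters the real calculus this
    way. *)
Lemma has_expectation_ge0 f a : measurable_fun [set: Omega] f ->
  (forall t, 0 <= f t) -> ('E_P[f] <= a%:E)%E ->
  exists2 e, has_expectation f e & e <= a.
Proof.
move=> mf f0 fa.
have E0 : (0 <= 'E_P[f])%E by exact: expectation_ge0.
have Efin : ('E_P[f])%E \is a fin_num.
  by rewrite ge0_fin_numE// (le_lt_trans fa)// ltry.
exists (fine ('E_P[f])%E); last by rewrite -lee_fin fineK.
split; last by rewrite fineK.
apply/integrableP; split; first exact/measurable_EFinP.
move: fa; rewrite unlock => fa; apply: le_lt_trans (ltry a).
apply: le_trans fa; rewrite le_eqVlt; apply/orP; left; apply/eqP.
by apply: eq_integral => t _; rewrite /= ger0_norm.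
Qed.

Lemma le_has_expectation f g b : measurable_fun [set: Omega] f ->
  (forall t, 0 <= f t <= g t) -> has_expectation g b ->
  ('E_P[f] <= b%:E)%E.
Proof.
move=> mf fg [intg <-]; apply: expectation_le => //.
- by apply/measurable_EFinP; exact: measurable_int intg.
- by move=> t; have /andP[] := fg t.
- by move=> t; have /andP[] := fg t; exact: le_trans.
- by apply: aeW => t; have /andP[] := fg t.
Qed.

(** The function is dominated by [1 + f ^+ 2], and constants are integrable for a probability. *)
Lemma has_expectation_of_sqr f a : measurable_fun [set: Omega] f ->
  has_expectation (fun t => f t ^+ 2) a -> P.-integrable [set: Omega] (EFin \o f).
Proof.
move=> mf hf.
have [int1 _] := has_expectationD (has_expectation_cst 1) hf.
apply: le_integrable int1 => //; first exact/measurable_EFinP.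
move=> t _; rewrite /= lee_fin [leRHS]ger0_norm; last by rewrite addr_ge0// sqr_ge0.
rewrite -(real_normK (num_real (f t))); have := sqr_ge0 (`|f t| - 1).
have := normr_ge0 (f t); nra.
Qed.

Lemma integrable_has_expectation f : P.-integrable [set: Omega] (EFin \o f) ->
  has_expectation f (fine ('E_P[f])%E).
Proof.
by move=> intf; split => //; rewrite fineK// expectation_fin_num//; apply/Lfun1_integrable.
Qed.

(** Squared mean plus variance, where the variances of the uncorrelated [Y i] add up. The square of
    the sum is expanded into a double sum in which only the diagonal differs from [mu i * mu i'].
    Later [c] is the deterministic part of a coordinate and [beta] is [- gamma / n]. *)
Lemma has_expectation_sqr_sum (I : finType) (Y : I -> Omega -> R) (c beta : R)
    (mu e : I -> R) :
  (forall i, has_expectation (Y i) (mu i)) ->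
  (forall i, has_expectation (fun t => Y i t ^+ 2) (e i)) ->
  (forall i i', i != i' -> has_expectation (fun t => Y i t * Y i' t) (mu i * mu i')) ->
  has_expectation (fun t => (c + beta * \sum_i Y i t) ^+ 2)
    ((c + beta * \sum_i mu i) ^+ 2 + beta ^+ 2 * \sum_i (e i - mu i ^+ 2)).
Proof.
move=> h1 h2 h12.
have -> : (c + beta * \sum_i mu i) ^+ 2 + beta ^+ 2 * \sum_i (e i - mu i ^+ 2) =
    c ^+ 2 + ((2 * c * beta) * \sum_i mu i) + beta ^+ 2 *
     \sum_i \sum_i' (if i == i' then e i else mu i * mu i').
  have -> : \sum_i \sum_i' (if i == i' then e i else mu i * mu i') =
      (\sum_i mu i) ^+ 2 + \sum_i (e i - mu i ^+ 2).
    rewrite expr2 mulr_suml -big_split; apply: eq_bigr => i _ /=.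
    rewrite mulr_sumr (bigD1 i)//= eqxx [in RHS](bigD1 i)//=.
    rewrite (eq_bigr (fun i' => mu i * mu i')); last first.
      by move=> i' ii'; rewrite eq_sym (negbTE ii').
    by ring.
  by ring.
apply: (@eq_has_expectation (fun t => c ^+ 2 + ((2 * c * beta) * \sum_i Y i t) +
    beta ^+ 2 * \sum_i \sum_i' Y i t * Y i' t)).
  move=> t; have -> : \sum_i \sum_i' Y i t * Y i' t = (\sum_i Y i t) ^+ 2.
    by rewrite expr2 mulr_suml; apply: eq_bigr => i _; rewrite mulr_sumr.
  by ring.
apply: has_expectationD; last first.
  apply: has_expectationZ; apply: has_expectation_sum => i.
  apply: has_expectation_sum => i'; case: eqVneq => [<-|]; last exact: h12.
  by apply: eq_has_expectation (h2 i) => t; rewrite expr2.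
apply: has_expectationD; first exact: has_expectation_cst.
by apply: has_expectationZ; exact: has_expectation_sum.
Qed.

End has_expectation.

(** * The sigma-algebras of the samples and their independence *)

Section sampling.
Context (R : realType) (n m : nat) (dO dX : measure_display)
  (Omega : measurableType dO) (Xi : measurableType dX) (P : probability Omega R)
  (nu : probability Xi R) (p : R) (j : nat -> 'I_n -> Omega -> 'I_m)
  (xi : nat -> 'I_n -> {RV P >-> Xi}) (b : nat -> Omega -> {ffun 'I_n -> bool}).
Hypothesis sampling : vr_diana_sampling nu p j xi b.

Let label : eqType := ((nat * 'I_n) + (nat * 'I_n) + nat)%type.
Let E : label -> set (set Omega) := sampling_events j xi b.
Let lj k i : label := inl (inl (k, i)).
Let lx k i : label := inl (inr (k, i)).
Let lb k : label := inr k.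

Lemma sampling_events_measurable (l : label) : E l `<=` measurable.
Proof.
case: l => [[[k i]|[k i]]|k] _ [B mB <-]; rewrite setTI.
- exact: (index_measurable sampling).
- by rewrite -[X in measurable X]setTI; exact: measurable_funPT.
- exact: (coin_measurable sampling).
Qed.

Lemma sampling_events_setT (l : label) : E l setT.
Proof.
by case: l => [[[k i]|[k i]]|k]; exists setT; rewrite ?setTI ?preimage_setT.
Qed.

Lemma sampling_events_setI (l : label) : setI_closed (E l).
Proof.
case: l => [[[k i]|[k i]]|k] _ _ [B mB <-] [C mC <-]; exists (B `&` C);
  rewrite ?setTI ?preimage_setI//.
exact: measurableI.
Qed.

Definition label_time (l : label) : nat :=
  match l with inl (inl (k, _)) => k | inl (inr (k, _)) => k | inr k => k end.

Lemma measurable_index (L : seq label) k i a : lj k i \in L ->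
  measurable ((j k i : sigma_of E L -> 'I_m) @^-1` [set a]).
Proof.
move=> kL; apply: sub_sigma_algebra.
apply: (sub_joint_events sampling_events_setT kL).
by exists [set a] => //; rewrite setTI.
Qed.

Lemma measurable_seed (L : seq label) k i : lx k i \in L ->
  measurable_fun [set: sigma_of E L] (xi k i : sigma_of E L -> Xi).
Proof.
move=> kL; apply: (measurable_sigma_ofP sampling_events_setT kL) => B mB.
by exists B => //; rewrite setTI.
Qed.

Lemma measurable_coin (L : seq label) k i : lb k \in L ->
  measurable ([set t | b k t i] : set (sigma_of E L)).
Proof.
move=> kL; apply: sub_sigma_algebra.
apply: (sub_joint_events sampling_events_setT kL).
by exists [set f : {ffun 'I_n -> bool} | f i] => //; rewrite setTI.
Qed.

Lemma ge0_integral_decouple (L1 L2 : seq label)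
    (f : sigma_of E L1 * sigma_of E L2 -> \bar R) : uniq (L1 ++ L2) ->
  measurable_fun [set: sigma_of E L1 * sigma_of E L2] f -> (forall z, 0 <= f z)%E ->
  (\int[P]_t f (t, t) = \int[P]_t \int[P]_t' f (t, t'))%E.
Proof.
move=> u12 mf f0.
apply: (@ge0_integral_independent _ _ _ _ _ (sigma_of E L1) (sigma_of E L2) P id id).
- exact: (measurable_sigma_of sampling_events_measurable).
- exact: (measurable_sigma_of sampling_events_measurable).
- move=> C D mC mD; exact: (independent_sigma_of (sampling_independent sampling)
    sampling_events_measurable sampling_events_setT sampling_events_setI u12).
- exact: mf.
- exact: f0.
Qed.

Lemma has_expectation_indepM (L1 L2 : seq label) (f g : Omega -> R) (u v : R) :
  uniq (L1 ++ L2) ->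
  measurable_fun [set: sigma_of E L1] (f : sigma_of E L1 -> R) ->
  measurable_fun [set: sigma_of E L2] (g : sigma_of E L2 -> R) ->
  has_expectation P f u -> has_expectation P g v ->
  has_expectation P (fun t => f t * g t) (u * v).
Proof.
move=> u12 mf mg [intf ef] [intg eg].
have [] := @expectation_independentM _ _ _ _ _ (sigma_of E L1) (sigma_of E L2) P
  id id (measurable_sigma_of (L := L1) sampling_events_measurable)
  (measurable_sigma_of (L := L2) sampling_events_measurable)
  (independent_sigma_of (sampling_independent sampling)
    sampling_events_measurable sampling_events_setT sampling_events_setI u12)
  f g mf mg intf intg.
by move=> ? h; split => //; rewrite h EFinM -ef -eg.
Qed.

Lemma has_expectation_seed k i (g : Xi -> R) u : measurable_fun [set: Xi] g ->
  has_expectation nu g u -> has_expectation P (g \o xi k i) u.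
Proof.
move=> mg [/integrableP[_ ig] eg].
have law (f : Xi -> \bar R) :
    (\int[distribution P (xi k i)]_z f z = \int[nu]_z f z)%E.
  by apply: eq_measure_integral => A mA _; exact: (seed_law sampling).
have intg : P.-integrable [set: Omega] (EFin \o (g \o xi k i)).
  apply/integrableP; split.
    by apply/measurable_EFinP; exact: measurableT_comp.
  have <- : (\int[distribution P (xi k i)]_z `|(g z)%:E| =
      \int[P]_t `|(EFin \o (g \o xi k i)) t|)%E.
    rewrite ge0_integral_distribution//.
    by apply: measurableT_comp => //; exact/measurable_EFinP.
  by rewrite law.
split => //; rewrite -eg unlock -law integral_distribution//.
exact/measurable_EFinP.
Qed.

(** Summing over the possible values [a] of the index, weighted by the indicator of the event that
    it equals [a], separates the index from the seed. Their independence and the uniform law of the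
    index then give the average. *)
Lemma has_expectation_index_seed k i (G : 'I_m -> Xi -> R) (e : 'I_m -> R) :
  (forall a, measurable_fun [set: Xi] (G a)) ->
  (forall a, has_expectation nu (G a) (e a)) ->
  has_expectation P (fun t => G (j k i t) (xi k i t)) (m%:R^-1 * \sum_a e a).
Proof.
move=> mG hG.
apply: (@eq_has_expectation _ _ _ _
  (fun t => \sum_a (j k i t == a)%:R * G a (xi k i t))).
  move=> t; rewrite (bigD1 (j k i t))//= eqxx mul1r big1 ?addr0// => a.
  by rewrite eq_sym => /negbTE ->; rewrite mul0r.
rewrite mulr_sumr; apply: has_expectation_sum => a.
have setE T (f : T -> 'I_m) : [set t | f t == a] = f @^-1` [set a].
  by apply/seteqP; split => t /= /eqP.
apply: (@has_expectation_indepM [:: lj k i] [:: lx k i]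
   (fun t => (j k i t == a)%:R) (G a \o xi k i)) => //.
- rewrite (_ : (fun t => _) = \1_((j k i : sigma_of E [:: lj k i] -> 'I_m) @^-1` [set a])).
    by apply: measurable_indic; apply: measurable_index; rewrite mem_head.
  by apply/funext => t; rewrite indicE -setE mem_setE.
- by apply: measurableT_comp => //; apply: measurable_seed; rewrite mem_head.
- apply: has_expectation_indic; rewrite setE.
    exact: (index_measurable sampling).
  exact: (index_uniform sampling).
- exact: has_expectation_seed.
Qed.

Lemma has_expectation_coin k i : has_expectation P (fun t => (b k t i)%:R) p.
Proof.
apply: has_expectation_indic; last exact: (coin_law sampling).
change (measurable (b k @^-1` [set f : {ffun 'I_n -> bool} | f i])).
exact: (coin_measurable sampling).
Qed.

Lemma worker_independent k i i' (f g : Omega -> R) (u v : R) : i != i' ->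
  measurable_fun [set: sigma_of E [:: lj k i; lx k i]]
    (f : sigma_of E [:: lj k i; lx k i] -> R) ->
  measurable_fun [set: sigma_of E [:: lj k i'; lx k i']]
    (g : sigma_of E [:: lj k i'; lx k i'] -> R) ->
  has_expectation P f u -> has_expectation P g v ->
  has_expectation P (fun t => f t * g t) (u * v).
Proof.
move=> ii'; apply: has_expectation_indepM.
have ji : (lj k i == lj k i') = false.
  by apply/eqP => -[h]; rewrite h eqxx in ii'.
have xi' : (lx k i == lx k i') = false.
  by apply/eqP => -[h]; rewrite h eqxx in ii'.
by rewrite /= !inE ji xi'.
Qed.

Definition labels_at (k : nat) : seq label :=
  [seq lj k i | i <- enum 'I_n] ++ [seq lx k i | i <- enum 'I_n] ++ [:: lb k].

Definition labels_before (k : nat) : seq label :=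
  flatten [seq labels_at k' | k' <- iota 0 k].

Lemma mem_labels_at k l : (l \in labels_at k) = (label_time l == k).
Proof.
rewrite !mem_cat inE; apply/idP/idP.
  by move=> /or3P[/mapP[i _ ->]|/mapP[i _ ->]|/eqP ->] /=.
case: l => [[[k' i]|[k' i]]|k'] /= /eqP ->; last by rewrite eqxx !orbT.
- by rewrite (map_f (lj k))// mem_enum.
- by rewrite (map_f (lx k)) ?orbT// mem_enum.
Qed.

Lemma mem_labels_before k l : (l \in labels_before k) = (label_time l < k)%N.
Proof.
apply/flatten_mapP/idP => [[k']|lk].
  by rewrite mem_iota add0n mem_labels_at => k'k /eqP ->.
by exists (label_time l); rewrite ?mem_iota ?mem_labels_at.
Qed.

Lemma uniq_labels_at k : uniq (labels_at k).
Proof.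
have uj : uniq [seq lj k i | i <- enum 'I_n].
  by rewrite map_inj_uniq ?enum_uniq// => i i' [].
have ux : uniq [seq lx k i | i <- enum 'I_n].
  by rewrite map_inj_uniq ?enum_uniq// => i i' [].
rewrite !cat_uniq uj ux /= orbF andbT -all_predC; apply/andP; split; last first.
  by apply/mapP => -[].
apply/allP => l; rewrite mem_cat inE => /orP[/mapP[i _ ->]|/eqP ->] /=;
  by apply/mapP => -[].
Qed.

Lemma uniq_labels k : uniq (labels_before k ++ labels_at k).
Proof.
elim: k => [|k ih]; first exact: uniq_labels_at.
have -> : labels_before k.+1 = labels_before k ++ labels_at k.
  by rewrite /labels_before -addn1 iotaD map_cat flatten_cat/= cats0.
rewrite cat_uniq ih uniq_labels_at andbT -all_predC; apply/allP => l /=.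
rewrite mem_labels_at mem_cat mem_labels_before mem_labels_at => /eqP ->.
by rewrite ltnNge leqnSn eq_sym neq_ltn ltnSn.
Qed.

End sampling.

(** * Contraction of the Lyapunov function *)

Section contraction_arithmetic.
Context (R : realType) (n : nat) (n_gt0 : (0 < n)%N).

(* The scalar form of the one-step contraction: H, B, N, Ax, Aw, e and q stand for
   |h_i - F_i xs|^2, |F_i x - F_i xs|^2, |F_i x - h_i|^2, the means over j of
   |F_ij x - F_ij xs|^2 and |F_ij w_i - F_ij xs|^2, E|Q(g_i - h_i)|^2 and
   <h_i - F_i xs, F_i x - h_i>. *)
Lemma contraction_arithmetic (gamma alpha omega p mu ell lh lt X D G M : R)
    (H B N Ax Aw e q : 'I_n -> R) :
  0 < gamma -> 0 < alpha -> 0 <= omega -> 0 < p -> 0 < mu -> 0 <= X ->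
  0 < lh -> 0 < lt ->
  (forall i, 0 <= H i) -> (forall i, 0 <= Aw i) ->
  alpha <= Num.min (p / 3) (1 / (1 + omega)) ->
  gamma <= (ell + 10 * (omega + 1) * (lh + lt) / n%:R
    + 4 * (omega + 1) * p * lt / (alpha * n%:R))^-1 ->
  0 < ell -> mu * X <= D -> G <= ell * D ->
  n%:R^-1 * \sum_i B i <= lh * D -> n%:R^-1 * \sum_i Ax i <= lt * D ->
  (forall i, N i <= 2 * B i + 2 * H i) ->
  (forall i, 2 * q i = B i - H i - N i) ->
  (forall i, e i <= (1 + omega) * (N i + (2 * Ax i + 2 * Aw i))) ->
  (forall i, 0 <= Ax i) -> (forall i, 0 <= N i) ->
  M = 4 * (omega + 1) * gamma ^+ 2 / (n%:R * alpha) ->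
  X - 2 * gamma * D + gamma ^+ 2 * G + (gamma / n%:R) ^+ 2 * (\sum_i (e i - N i))
   + M * (n%:R^-1 * \sum_i (H i + 2 * alpha * q i + alpha ^+ 2 * e i)
     + n%:R^-1 * \sum_i (p * Ax i + (1 - p) * Aw i))
  <= (1 - Num.min (gamma * mu) (alpha / 2)) *
     (X + M * (n%:R^-1 * \sum_i H i + n%:R^-1 * \sum_i Aw i)).
Proof.
move=> g0 a0 o0 p0 mu0 X0 lh0 lt0 H0 Aw0 a_le g_le ell0 muX GD BD AD NBH qE e_le Ax0 N0 ME0.
have nn0 : 0 < n%:R :> R by rewrite ltr0n.
move: a_le; rewrite le_min => /andP[ap ao].
have {}ao : alpha * (1 + omega) <= 1 by rewrite -ler_pdivlMr//; lra.
have {}ap : 3 * alpha <= p by move: ap; rewrite ler_pdivlMr//; lra.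
pose S (f : 'I_n -> R) := n%:R^-1 * \sum_i f i.
have SD f g : S (fun i => f i + g i) = S f + S g by rewrite /S big_split mulrDr.
have SZ c f : S (fun i => c * f i) = c * S f by rewrite /S -mulr_sumr mulrCA.
have Sle f g : (forall i, f i <= g i) -> S f <= S g.
  by move=> fg; rewrite ler_pM2l ?invr_gt0//; apply: ler_sum.
have S0 f : (forall i, 0 <= f i) -> 0 <= S f.
  by move=> f0; rewrite mulr_ge0 ?sumr_ge0// invr_ge0 ltW.
have [kap kapE] : exists kap, kap = (omega + 1) / n%:R by eexists.
have kap0 : 0 < kap by rewrite kapE divr_gt0//; lra.
have ME : M = 4 * kap * gamma ^+ 2 / alpha.
  by rewrite ME0 kapE; field; rewrite !gt_eqF.
have M0 : 0 < M by rewrite ME divr_gt0// mulr_gt0 ?exprn_gt0// mulr_gt0.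
have D0 : 0 <= D by apply: le_trans muX; rewrite mulr_ge0// ltW.
(* Since [M * (alpha / 2)] equals [2 * kap * gamma ^+ 2], this is the compression noise with each
   [N i] bounded by [2 * B i + 2 * H i]. *)
have noise : (gamma / n%:R) ^+ 2 * (\sum_i (e i - N i)) <=
    M * (alpha / 2) * (S B + S H + S Ax + S Aw).
  have -> : (gamma / n%:R) ^+ 2 * (\sum_i (e i - N i)) =
      gamma ^+ 2 / n%:R * S (fun i => e i - N i).
    by rewrite /S; field; rewrite gt_eqF.
  have -> : M * (alpha / 2) * (S B + S H + S Ax + S Aw) = gamma ^+ 2 / n%:R *
      ((1 + omega) * (2 * S B + 2 * S H + 2 * S Ax + 2 * S Aw)).
    by rewrite ME kapE; field; rewrite !gt_eqF.
  rewrite ler_pM2l ?divr_gt0 ?exprn_gt0//.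
  rewrite -!SZ -!SD -SZ; apply: Sle => i.
  have := e_le i; have := NBH i; have := N0 i; nra.
(* The condition [alpha * (1 + omega) <= 1] reduces the quadratic term to order [alpha]; its
   [alpha * N i] then cancels against the one contributed by [2 * alpha * q i]. *)
have shift : S (fun i => H i + 2 * alpha * q i + alpha ^+ 2 * e i) <=
    (1 - alpha) * S H + alpha * S B + alpha * (2 * S Ax + 2 * S Aw).
  have -> : (1 - alpha) * S H + alpha * S B + alpha * (2 * S Ax + 2 * S Aw) =
      S (fun i => (1 - alpha) * H i + alpha * B i + alpha * (2 * Ax i + 2 * Aw i)).
    by rewrite !(SD, SZ).
  apply: Sle => i.
  have -> : 2 * alpha * q i = alpha * (B i - H i - N i) by rewrite -qE; ring.
  have : alpha ^+ 2 * e i <= alpha * (N i + (2 * Ax i + 2 * Aw i)).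
    rewrite expr2 -mulrA ler_pM2l//.
    have U0 : 0 <= N i + (2 * Ax i + 2 * Aw i).
      have := N0 i; have := Ax0 i; have := Aw0 i; lra.
    apply: (@le_trans _ _ (alpha * ((1 + omega) * (N i + (2 * Ax i + 2 * Aw i))))).
      by rewrite ler_pM2l.
    by rewrite mulrA ler_piMl.
  lra.
have coin : S (fun i => p * Ax i + (1 - p) * Aw i) = p * S Ax + (1 - p) * S Aw.
  by rewrite SD !SZ.
rewrite -!/(S _) coin.
have lam : Num.min (gamma * mu) (alpha / 2) <= gamma * mu by rewrite ge_min lexx.
have lam' : Num.min (gamma * mu) (alpha / 2) <= alpha / 2.
  by rewrite ge_min lexx orbT.
set la := Num.min _ _ in lam lam' *.
(* The inverse of the bound on [gamma]. As [M * alpha = 4 * kap * gamma ^+ 2], the terms in [D]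
   require, besides [ell], the coefficient [6 * kap * lh + 10 * kap * lt + 4 * kap * p * lt /
   alpha]; the surplus [4 * kap * lh] is the term subtracted in [drift]. *)
pose C := ell + 10 * kap * (lh + lt) + 4 * kap * p * lt / alpha.
have C0 : 0 < C.
  have : 0 < 10 * kap * (lh + lt) by rewrite !mulr_gt0// ?addr_gt0.
  have : 0 < 4 * kap * p * lt / alpha by rewrite divr_gt0// !mulr_gt0.
  by rewrite /C; lra.
have gC : gamma * C <= 1.
  rewrite -ler_pdivlMr// mul1r; move: g_le; congr (_ <= _^-1).
  by rewrite /C kapE; field; rewrite !gt_eqF.
have SH0 : 0 <= S H by exact: S0.
have SA0 : 0 <= S Aw by exact: S0.
have BD' : S B <= lh * D by [].
have AD' : S Ax <= lt * D by [].
have drift : X - 2 * gamma * D + gamma ^+ 2 * (ell * D) +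
    M * (alpha / 2) * (lh * D + lt * D) +
    M * (alpha * (lh * D) + 2 * alpha * (lt * D) + p * (lt * D)) <= (1 - la) * X.
  have -> : X - 2 * gamma * D + gamma ^+ 2 * (ell * D) +
    M * (alpha / 2) * (lh * D + lt * D) +
    M * (alpha * (lh * D) + 2 * alpha * (lt * D) + p * (lt * D)) =
    X - 2 * gamma * D + gamma * (gamma * C) * D - 4 * kap * gamma ^+ 2 * (lh * D).
    by rewrite ME /C; field; rewrite gt_eqF.
  have h1 : gamma * (gamma * C) * D <= gamma * D.
    by rewrite ler_wpM2r// ler_piMr// ltW.
  have h2 : 0 <= 4 * kap * gamma ^+ 2 * (lh * D).
    by rewrite !mulr_ge0// ?sqr_ge0 ?ltW//.
  have h3 : gamma * (mu * X) <= gamma * D by rewrite ler_pM2l.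
  have h4 : la * X <= gamma * mu * X by rewrite ler_wpM2r.
  lra.
(* The factor of [S H] is exactly [1 - alpha / 2]. That of [S Aw] gathers [alpha / 2] from the
   noise, [2 * alpha] from the shifts and [1 - p] from the coins; it is at most [1 - alpha / 2]
   because [3 * alpha <= p]. *)
have mem : M * ((1 - alpha + alpha / 2) * S H + (alpha / 2 + 2 * alpha + 1 - p) * S Aw)
    <= (1 - la) * (M * (S H + S Aw)).
  rewrite [leRHS]mulrCA ler_pM2l// mulrDr lerD// ler_wpM2r//; lra.
have t1 : gamma ^+ 2 * G <= gamma ^+ 2 * (ell * D).
  by rewrite ler_pM2l// exprn_gt0.
have t2 : M * (alpha / 2) * (S B + S H + S Ax + S Aw) <=
    M * (alpha / 2) * (lh * D + S H + lt * D + S Aw).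
  by rewrite ler_pM2l ?mulr_gt0//; lra.
have t3 : M * (S (fun i => H i + 2 * alpha * q i + alpha ^+ 2 * e i) +
      (p * S Ax + (1 - p) * S Aw)) <=
    M * ((1 - alpha) * S H + alpha * (lh * D) + alpha * (2 * (lt * D) + 2 * S Aw)
      + (p * (lt * D) + (1 - p) * S Aw)).
  rewrite ler_pM2l//.
  have h1 : alpha * S B <= alpha * (lh * D) by rewrite ler_pM2l.
  have h2 : alpha * S Ax <= alpha * (lt * D) by rewrite ler_pM2l.
  have h3 : p * S Ax <= p * (lt * D) by rewrite ler_pM2l.
  lra.
lra.
Qed.

End contraction_arithmetic.

(** * Moments of the compressor and of the messages *)

Section compressor.
Context (R : realType) (d : nat) (dX : measure_display) (Xi : measurableType dX)
  (nu : probability Xi R) (omega : R) (Q : 'rV[R]_d -> Xi -> 'rV[R]_d).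
Hypothesis Q_compressor : unbiased_compressor nu omega Q.

Lemma bmeasurable_compressor (dT : measure_display) (T : measurableType dT)
    (y : T -> 'rV[R]_d) (z : T -> Xi) :
  bmeasurable y -> measurable_fun [set: T] z -> bmeasurable (fun t => Q (y t) (z t)).
Proof.
move=> my mz.
have myz : measurable_fun [set: T] (fun t => (y t, z t) : borel R d * Xi).
  exact: measurable_fun_pair.
exact: (measurableT_comp (compressor_measurable Q_compressor) myz).
Qed.

(** The bound is the decomposition of the second moment into squared mean plus variance.
    Integrability of the coordinates of [Q y] is deduced from the variance bound, through the
    squares of the coordinates of [Q y - y]. Second moments are kept per coordinate because the
    cross terms between workers are treated coordinatewise. *)
Lemma compressor_moments y : exists e : 'I_d -> R,
  [/\ forall c, has_expectation nu (fun z => Q y z ord0 c) (y ord0 c),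
      forall c, has_expectation nu (fun z => Q y z ord0 c ^+ 2) (e c) &
      \sum_c e c <= (1 + omega) * enorm y ^+ 2].
Proof.
have mQ : bmeasurable (Q y).
  by apply: bmeasurable_compressor => //; exact: bmeasurable_cst.
have mQy : bmeasurable (fun z => Q y z - y).
  by apply: bmeasurableB => //; exact: bmeasurable_cst.
have [v hv v_le] := has_expectation_ge0 (measurable_enorm_sq mQy)
  (fun z => sqr_ge0 _) (compressor_var Q_compressor y).
have mf c : measurable_fun [set: Xi] (fun z => (Q y z - y) ord0 c).
  exact: bmeasurable_coord.
have /choice[u hu] c : exists u, has_expectation nu (fun z => (Q y z - y) ord0 c ^+ 2) u.
  have [] := has_expectation_ge0 (measurable_funX 2 (mf c)) (fun z => sqr_ge0 _)
    (le_has_expectation (measurable_funX 2 (mf c)) _ hv).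
    by move=> z; rewrite sqr_ge0 coord_le_enorm.
  by move=> u hu _; exists u.
have mean c : has_expectation nu (fun z => Q y z ord0 c) (y ord0 c).
  split; last exact: (compressor_mean Q_compressor).
  have intf := integrable_has_expectation (has_expectation_of_sqr (mf c) (hu c)).
  have [+ _] := has_expectationD intf (has_expectation_cst nu (y ord0 c)).
  by apply: eq_integrable => // z _; rewrite /= !mxE subrK.
exists (fun c => u c + y ord0 c ^+ 2); split => // [c|].
  (* Mirrors the expansion of the square of the coordinate [Q] as [(Q - y)^2 + 2 y Q - y^2], whose
     three terms have known expectations. *)
  have -> : u c + y ord0 c ^+ 2 = (u c + (2 * y ord0 c) * y ord0 c) + - y ord0 c ^+ 2.
    by ring.
  have h1 := has_expectationZ (2 * y ord0 c) (mean c).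
  have h2 := has_expectationD (has_expectationD (hu c) h1)
    (has_expectation_cst nu (- y ord0 c ^+ 2)).
  by apply: eq_has_expectation h2 => z; rewrite !mxE; ring.
rewrite big_split/= -enorm_sqE mulrDl mul1r addrC lerD2l.
suff -> : \sum_c u c = v by [].
apply: (has_expectation_unique (P := nu) (f := fun z => enorm (Q y z - y) ^+ 2)) => //.
apply: eq_has_expectation (has_expectation_sum _ hu) => z.
by rewrite enorm_sqE.
Qed.

End compressor.

Section mean_vectors.
Context (R : realType) (d m : nat) (m_gt0 : (0 < m)%N).

(** The two sides differ by the squared norm of the mean of [z]: a variance is bounded by a second
    moment. Here [z a] will be the difference of [Fij i a] between [x] and [w i], and [v] the part
    that does not depend on the index. *)
Lemma mean_enorm_sq_le (z : 'I_m -> 'rV[R]_d) (v : 'rV[R]_d) :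
  m%:R^-1 * \sum_a enorm (z a + v) ^+ 2 <=
  enorm (m%:R^-1 *: \sum_a z a + v) ^+ 2 + m%:R^-1 * \sum_a enorm (z a) ^+ 2.
Proof.
have m0 : m%:R != 0 :> R by rewrite pnatr_eq0 -lt0n.
have dot_sum : dot (\sum_a z a) v = \sum_a dot (z a) v.
  rewrite /dot exchange_big/=; apply: eq_bigr => c _.
  by rewrite summxE mulr_suml.
have -> : \sum_a enorm (z a + v) ^+ 2 =
    \sum_a enorm (z a) ^+ 2 + 2 * dot (\sum_a z a) v + m%:R * dot v v.
  rewrite dot_sum mulr_sumr -big_split/= mulr_natl -[m in X in _ = _ + X]card_ord.
  rewrite -sumr_const -big_split/=; apply: eq_bigr => a _.
  by rewrite !enorm_sq !(dotDl, dotDr) (dotC v); ring.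
set w := \sum_a z a; set S := \sum_a _.
rewrite [leRHS](_ : _ = enorm (m%:R^-1 *: w) ^+ 2 +
    m%:R^-1 * (S + 2 * dot w v + m%:R * dot v v)).
  by rewrite lerDr sqr_ge0.
by rewrite !enorm_sq !(dotDl, dotDr, dotZl, dotZr) (dotC v); field.
Qed.

End mean_vectors.

Section message.
Context (R : realType) (d n m : nat) (dO dX : measure_display)
  (Omega : measurableType dO) (Xi : measurableType dX) (P : probability Omega R)
  (nu : probability Xi R) (p : R) (j : nat -> 'I_n -> Omega -> 'I_m)
  (xi : nat -> 'I_n -> {RV P >-> Xi}) (b : nat -> Omega -> {ffun 'I_n -> bool}).
Hypothesis sampling : vr_diana_sampling nu p j xi b.
Context (omega : R) (Q : 'rV[R]_d -> Xi -> 'rV[R]_d).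
Hypothesis Q_compressor : unbiased_compressor nu omega Q.
Hypotheses (m_gt0 : (0 < m)%N) (omega_ge0 : 0 <= omega).

(** Here [delta a] is the vector to be compressed when index [a] is drawn: the moments of the
    compressor at each [delta a] are averaged over the index. *)
Lemma message_moments k i (delta : 'I_m -> 'rV[R]_d) :
  let Y t := Q (delta (j k i t)) (xi k i t) in
  exists e : 'I_d -> R,
  [/\ forall c, has_expectation P (fun t => Y t ord0 c)
        ((m%:R^-1 *: \sum_a delta a) ord0 c),
      forall c, has_expectation P (fun t => Y t ord0 c ^+ 2) (e c) &
      \sum_c e c <= (1 + omega) * (m%:R^-1 * \sum_a enorm (delta a) ^+ 2)].
Proof.
move=> Y.
have /choice[e he] a := compressor_moments Q_compressor (delta a).
have mQ a c : measurable_fun [set: Xi] (fun z => Q (delta a) z ord0 c).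
  apply: bmeasurable_coord; apply: (bmeasurable_compressor Q_compressor) => //.
  exact: bmeasurable_cst.
exists (fun c => m%:R^-1 * \sum_a e a c); split => [c|c|].
- have := has_expectation_index_seed sampling k i
    (G := fun a z => Q (delta a) z ord0 c) (e := fun a => delta a ord0 c).
  by rewrite mxE summxE; apply => a //; have [] := he a.
- apply: (has_expectation_index_seed sampling k i
    (G := fun a z => Q (delta a) z ord0 c ^+ 2)) => a.
    exact: measurable_funX.
  by have [] := he a.
- rewrite -mulr_sumr mulrCA ler_pM2l ?invr_gt0 ?ltr0n// exchange_big/= mulr_sumr.
  by apply: ler_sum => a _; have [] := he a.
Qed.

Lemma message_uncorrelated k i i' (delta delta' : 'I_m -> 'rV[R]_d) c (u v : R) :
  let Y t := Q (delta (j k i t)) (xi k i t) in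
  let Y' t := Q (delta' (j k i' t)) (xi k i' t) in
  i != i' -> has_expectation P (fun t => Y t ord0 c) u ->
  has_expectation P (fun t => Y' t ord0 c) v ->
  has_expectation P (fun t => Y t ord0 c * Y' t ord0 c) (u * v).
Proof.
move=> Y Y' ii'; apply: (worker_independent sampling (k := k) ii').
- apply: bmeasurable_coord; apply: (bmeasurable_compressor Q_compressor).
    apply: (bmeasurable_switch (F := fun a _ => delta a)) => a.
      by apply: measurable_index; rewrite !inE eqxx.
    exact: bmeasurable_cst.
  by apply: measurable_seed; rewrite !inE eqxx orbT.
- apply: bmeasurable_coord; apply: (bmeasurable_compressor Q_compressor).
    apply: (bmeasurable_switch (F := fun a _ => delta' a)) => a.
      by apply: measurable_index; rewrite !inE eqxx.
    exact: bmeasurable_cst.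
  by apply: measurable_seed; rewrite !inE eqxx orbT.
Qed.

End message.

(** * The Lyapunov function and its decrease in one step *)

Section lyapunov.
Context (R : realType) (d n m : nat).
Variables (Fij : 'I_n -> 'I_m -> 'rV[R]_d -> 'rV[R]_d)
  (Fi : 'I_n -> 'rV[R]_d -> 'rV[R]_d) (xs : 'rV[R]_d) (M : R).

Definition lyapunov (s : diana_state R d n) : R :=
  enorm (st_x s - xs) ^+ 2 +
  M * (n%:R^-1 * (\sum_(i < n) enorm (st_hi s i - Fi i xs) ^+ 2) +
    (n%:R * m%:R)^-1 * (\sum_(i < n) \sum_(j < m)
      enorm (Fij i j (st_w s i) - Fij i j xs) ^+ 2)).

Lemma lyapunov_ge0 s : 0 <= M -> 0 <= lyapunov s.
Proof.
move=> M0; apply: addr_ge0; first exact: sqr_ge0.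
apply: mulr_ge0 => //; apply: addr_ge0; apply: mulr_ge0;
  rewrite ?invr_ge0 ?mulr_ge0// ?ler0n//; apply: sumr_ge0 => i _.
  exact: sqr_ge0.
by apply: sumr_ge0 => a _; exact: sqr_ge0.
Qed.

Lemma measurable_lyapunov (dT : measure_display) (T : measurableType dT)
    (S : T -> diana_state R d n) :
  (forall i j, measurable_fun [set: borel R d] (Fij i j : borel R d -> borel R d)) ->
  state_measurable S -> measurable_fun [set: T] (fun t => lyapunov (S t)).
Proof.
move=> mFij [mx _ mh mw].
apply: measurable_funD.
  by apply: measurable_enorm_sq; apply: bmeasurableB => //; exact: bmeasurable_cst.
apply: measurable_funM => //; apply: measurable_funD.
  apply: measurable_funM => //; apply: measurable_sum => i.
  by apply: measurable_enorm_sq; apply: bmeasurableB => //; exact: bmeasurable_cst.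
apply: measurable_funM => //; apply: measurable_sum => i; apply: measurable_sum => a.
apply: measurable_enorm_sq; apply: bmeasurableB => //; last exact: bmeasurable_cst.
exact: (bmeasurable_comp (mFij i a) (mw i)).
Qed.

End lyapunov.

Section one_step.
Context (R : realType) (d n m : nat) (n_gt0 : (0 < n)%N) (m_gt0 : (0 < m)%N).
Variables (Fij : 'I_n -> 'I_m -> 'rV[R]_d -> 'rV[R]_d)
  (Fi : 'I_n -> 'rV[R]_d -> 'rV[R]_d) (F : 'rV[R]_d -> 'rV[R]_d).
Hypotheses (FiE : forall i, Fi i = mean_op (Fij i)) (FE : F = mean_op Fi)
  (Fij_borel : forall i j,
    measurable_fun [set: borel R d] (Fij i j : borel R d -> borel R d)).
Variables (r : 'rV[R]_d -> \bar R) (xs : 'rV[R]_d) (mu ell ellhat elltilde : R).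
Hypotheses (mu_gt0 : 0 < mu) (ell_gt0 : 0 < ell) (ellhat_gt0 : 0 < ellhat)
  (elltilde_gt0 : 0 < elltilde).
Hypotheses
  (F_qsm : forall x, mu * enorm (x - xs) ^+ 2 <= dot (F x - F xs) (x - xs))
  (F_cocoercive : forall x,
    enorm (F x - F xs) ^+ 2 <= ell * dot (F x - F xs) (x - xs))
  (Fi_cocoercive : forall x,
    n%:R^-1 * (\sum_(i < n) enorm (Fi i x - Fi i xs) ^+ 2)
    <= ellhat * dot (F x - F xs) (x - xs))
  (Fij_cocoercive : forall x,
    (n%:R * m%:R)^-1 *
      (\sum_(i < n) \sum_(j < m) enorm (Fij i j x - Fij i j xs) ^+ 2)
    <= elltilde * dot (F x - F xs) (x - xs)).
Context (dO dX : measure_display) (Omega : measurableType dO)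
  (Xi : measurableType dX) (P : probability Omega R) (nu : probability Xi R)
  (omega : R) (omega_ge0 : 0 <= omega) (Q : 'rV[R]_d -> Xi -> 'rV[R]_d).
Hypothesis Q_compressor : unbiased_compressor nu omega Q.
Context (p : R) (p_gt0 : 0 < p) (p_le1 : p <= 1) (j : nat -> 'I_n -> Omega -> 'I_m)
  (xi : nat -> 'I_n -> {RV P >-> Xi}) (b : nat -> Omega -> {ffun 'I_n -> bool}).
Hypothesis sampling : vr_diana_sampling nu p j xi b.
Variables (gamma alpha : R).
Hypotheses (alpha_gt0 : 0 < alpha)
  (alpha_le : alpha <= Num.min (p / 3) (1 / (1 + omega)))
  (gamma_gt0 : 0 < gamma)
  (gamma_le : gamma <=
     (ell + 10 * (omega + 1) * (ellhat + elltilde) / n%:R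
      + 4 * (omega + 1) * p * elltilde / (alpha * n%:R))^-1).
Hypothesis prox_dist : forall x,
  enorm (prox gamma r x - xs) ^+ 2 <= enorm (x - (xs - gamma *: F xs)) ^+ 2.
Hypothesis mprox :
  measurable_fun [set: borel R d] (prox gamma r : borel R d -> borel R d).

Let M := 4 * (omega + 1) * gamma ^+ 2 / (n%:R * alpha).
Let lyap := lyapunov Fij Fi xs M.
Let rho := 1 - Num.min (gamma * mu) (alpha / 2).
Let step k t s := vr_diana_step Fij r gamma alpha (fun i => j k i t)
  (fun i y => Q y (xi k i t)) (b k t) s.

Let nn0 : 0 < n%:R :> R. Proof. by rewrite ltr0n. Qed.
Let mm0 : 0 < m%:R :> R. Proof. by rewrite ltr0n. Qed.

Let M_ge0 : 0 <= M.
Proof.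
by rewrite divr_ge0// mulr_ge0 ?sqr_ge0 ?addr_ge0 ?ler0n ?(ltW alpha_gt0)//
  mulr_ge0 ?addr_ge0.
Qed.

Let rho_ge0 : 0 <= rho.
Proof.
have /andP[a3 _] : (alpha <= p / 3) && (alpha <= 1 / (1 + omega)).
  by move: alpha_le; rewrite le_min.
have half : alpha / 2 <= 1 by have := p_le1; lra.
by rewrite subr_ge0 (le_trans _ half)// ge_min lexx orbT.
Qed.

(** The hypothesis on [st_h] makes the estimator unbiased: the shift [h] plus the mean of the [mi i]
    is [F x]. The prox is not computed; the new value is dominated pointwise by [W], a polynomial in
    the messages and coins, whose expectation [W0] is explicit and has the form treated by
    [contraction_arithmetic]. *)
Lemma one_step k (s : diana_state R d n) :
  st_h s = n%:R^-1 *: \sum_(i < n) st_hi s i ->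
  ('E_P[fun t => lyap (step k t s)] <= (rho * lyap s)%:E)%E.
Proof.
move=> hs.
pose x := st_x s; pose h := st_h s; pose hi := st_hi s; pose w := st_w s.
(* The uncompressed message of worker [i] when index [a] is drawn; [mi i] is its mean over [a]. *)
pose delta i a := Fij i a x - Fij i a (w i) + mean_op (Fij i) (w i) - hi i.
pose mi i := Fi i x - hi i.
pose Y i t := Q (delta i (j k i t)) (xi k i t).
pose Ax i := m%:R^-1 * \sum_a enorm (Fij i a x - Fij i a xs) ^+ 2.
pose Aw i := m%:R^-1 * \sum_a enorm (Fij i a (w i) - Fij i a xs) ^+ 2.
have miE i : mi i = m%:R^-1 *: \sum_a delta i a.
  have -> : \sum_a delta i a = \sum_a Fij i a x - \sum_a Fij i a (w i) +
      m%:R *: (mean_op (Fij i) (w i) - hi i).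
    rewrite scaler_nat -sumrB.
    have := sumr_const 'I_m (mean_op (Fij i) (w i) - hi i); rewrite card_ord => <-.
    by rewrite -big_split/=; apply: eq_bigr => a _; rewrite /delta addrA.
  rewrite scalerDr scalerBr scalerA mulVf ?gt_eqF// scale1r /mi FiE.
  by rewrite -/(mean_op (Fij i) x) -/(mean_op (Fij i) (w i)) addrA subrK.
have /choice[e he] i := message_moments sampling Q_compressor m_gt0 k i (delta i).
have hY i c : has_expectation P (fun t => Y i t ord0 c) (mi i ord0 c).
  by rewrite miE; have [+ _ _] := he i; apply.
have hY2 i c : has_expectation P (fun t => Y i t ord0 c ^+ 2) (e i c).
  by have [_ + _] := he i; apply.
have hYY i i' c : i != i' ->
    has_expectation P (fun t => Y i t ord0 c * Y i' t ord0 c)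
      (mi i ord0 c * mi i' ord0 c).
  by move=> ii'; exact: (message_uncorrelated sampling Q_compressor ii' (hY i c) (hY i' c)).
pose c0 c := (x - gamma *: h - (xs - gamma *: F xs)) ord0 c.
pose ai i c := (hi i - Fi i xs) ord0 c.
(* The prox is replaced by its argument, compared with [xs - gamma *: F xs]. The coin's choice
   between [Ax i] and [Aw i] becomes an affine function of its indicator. *)
pose W t := \sum_c (c0 c + (- (gamma / n%:R)) * \sum_i Y i t ord0 c) ^+ 2 +
  M * (n%:R^-1 * \sum_i \sum_c (ai i c ^+ 2 + (2 * ai i c * alpha) * Y i t ord0 c +
      alpha ^+ 2 * Y i t ord0 c ^+ 2) +
    n%:R^-1 * \sum_i (Aw i + (Ax i - Aw i) * (b k t i)%:R)).
pose W0 := \sum_c ((c0 c + (- (gamma / n%:R)) * \sum_i mi i ord0 c) ^+ 2 +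
    (- (gamma / n%:R)) ^+ 2 * \sum_i (e i c - mi i ord0 c ^+ 2)) +
  M * (n%:R^-1 * \sum_i \sum_c (ai i c ^+ 2 + (2 * ai i c * alpha) * mi i ord0 c +
      alpha ^+ 2 * e i c) +
    n%:R^-1 * \sum_i (Aw i + (Ax i - Aw i) * p)).
have hW : has_expectation P W W0.
  apply: has_expectationD.
    apply: has_expectation_sum => c; apply: has_expectation_sqr_sum => //.
    by move=> i i'; exact: hYY.
  apply: has_expectationZ; apply: has_expectationD; apply: has_expectationZ;
    apply: has_expectation_sum => i.
    apply: has_expectation_sum => c; apply: has_expectationD.
      by apply: has_expectationD; [exact: has_expectation_cst|exact: has_expectationZ].
    exact: has_expectationZ.
  apply: has_expectationD; first exact: has_expectation_cst.
  by apply: has_expectationZ; exact: (has_expectation_coin sampling).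
have le_W t : lyap (step k t s) <= W t.
  have -> : step k t s = {|
      st_x := prox gamma r (x - gamma *: (h + n%:R^-1 *: \sum_i Y i t));
      st_h := h + (alpha / n%:R) *: \sum_i Y i t;
      st_hi := fun i => hi i + alpha *: Y i t;
      st_w := fun i => if b k t i then x else w i |} by [].
  rewrite /lyap /lyapunov /=.
  apply: lerD.
    apply: (le_trans (prox_dist _)).
    rewrite enorm_sqE le_eqVlt; apply/orP; left; apply/eqP; apply: eq_bigr => c _.
    by rewrite /c0 !mxE !summxE; congr (_ ^+ 2); ring.
  rewrite ler_wpM2l//; apply: lerD.
    rewrite ler_pM2l ?invr_gt0//; apply: ler_sum => i _.
    rewrite enorm_sqE le_eqVlt; apply/orP; left; apply/eqP; apply: eq_bigr => c _.
    by rewrite /ai !mxE; ring.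
  rewrite invfM -mulrA ler_pM2l ?invr_gt0// mulr_sumr; apply: ler_sum => i _.
  by case: ifP => _; rewrite ?mulr1 ?mulr0 ?addr0// addrC subrK.
have mlyap : measurable_fun [set: Omega] (fun t => lyap (step k t s)).
  apply: measurable_lyapunov => //.
  apply: (state_measurable_step alpha Fij_borel (compressor_measurable Q_compressor) mprox
    (S := fun=> s)).
  - by split => *; exact: bmeasurable_cst.
  - by move=> i a; exact: (index_measurable sampling).
  - by move=> i; exact: measurable_funPT.
  - move=> i; change (measurable (b k @^-1` [set f : {ffun 'I_n -> bool} | f i])).
    exact: (coin_measurable sampling).
apply: (le_trans (le_has_expectation mlyap _ hW)).
  by move=> t; rewrite le_W lyapunov_ge0.
rewrite lee_fin.
pose D := dot (F x - F xs) (x - xs).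
have nM : forall f : 'I_n -> 'I_m -> R, (n%:R * m%:R)^-1 * \sum_i \sum_a f i a =
    n%:R^-1 * \sum_i (m%:R^-1 * \sum_a f i a).
  by move=> f; rewrite invfM -mulrA -mulr_sumr.
have W0E : W0 = enorm (x - xs) ^+ 2 - 2 * gamma * D +
    gamma ^+ 2 * enorm (F x - F xs) ^+ 2 +
    (gamma / n%:R) ^+ 2 * (\sum_i (\sum_c e i c - enorm (mi i) ^+ 2)) +
    M * (n%:R^-1 * \sum_i (enorm (hi i - Fi i xs) ^+ 2 +
         2 * alpha * dot (hi i - Fi i xs) (mi i) + alpha ^+ 2 * \sum_c e i c) +
      n%:R^-1 * \sum_i (p * Ax i + (1 - p) * Aw i)).
  rewrite /W0; congr (_ + M * (_ * _ + _ * _)); last first.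
  - by apply: eq_bigr => i _; ring.
  - apply: eq_bigr => i _; rewrite !big_split/= enorm_sqE -mulr_sumr; congr (_ + _ + _).
    by rewrite mulr_sumr; apply: eq_bigr => c _; rewrite /ai; ring.
  rewrite big_split/=; congr (_ + _); last first.
    rewrite -mulr_sumr sqrrN exchange_big/=; congr (_ * _).
    by apply: eq_bigr => i _; rewrite sumrB -enorm_sqE.
  have -> : enorm (x - xs) ^+ 2 - 2 * gamma * D + gamma ^+ 2 * enorm (F x - F xs) ^+ 2
      = enorm ((x - xs) - gamma *: (F x - F xs)) ^+ 2.
    rewrite /D; move: (F x - F xs) (x - xs) => u v.
    by rewrite !enorm_sq !(dotBl, dotBr, dotZl, dotZr) (dotC v); ring.
  have FxE : F x = h + n%:R^-1 *: \sum_i mi i.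
    by rewrite /h hs FE /mean_op /mi sumrB scalerBr addrC subrK.
  rewrite enorm_sqE; apply: eq_bigr => c _; congr (_ ^+ 2).
  by rewrite /c0 !mxE FxE !mxE summxE; ring.
have lyapE : lyap s = enorm (x - xs) ^+ 2 +
    M * (n%:R^-1 * (\sum_i enorm (hi i - Fi i xs) ^+ 2) + n%:R^-1 * \sum_i Aw i).
  by rewrite /lyap /lyapunov nM.
rewrite W0E lyapE /rho.
apply: (@contraction_arithmetic _ _ n_gt0 _ _ omega p mu ell ellhat elltilde _ D _ _ _
  (fun i => enorm (Fi i x - Fi i xs) ^+ 2) _ Ax _) => //.
- exact: sqr_ge0.
- by move=> i; exact: sqr_ge0.
- by move=> i; rewrite mulr_ge0 ?sumr_ge0 ?invr_ge0 ?ler0n// => a _; exact: sqr_ge0.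
- by have := Fij_cocoercive x; rewrite nM.
- by move=> i; exact: enorm_sqB2.
(* Polarization of the sum of [F_i x - h_i] and [h_i - F_i xs]. *)
- move=> i; have -> : Fi i x - Fi i xs = mi i + (hi i - Fi i xs).
    by rewrite /mi addrA subrK.
  move: (mi i) (hi i - Fi i xs) => u v.
  by rewrite !enorm_sq !(dotDl, dotDr) (dotC v); ring.
- move=> i; have [_ _ /le_trans] := he i; apply.
  rewrite ler_wpM2l ?addr_ge0//.
  pose v := mean_op (Fij i) (w i) - hi i.
  have -> : \sum_a enorm (delta i a) ^+ 2 =
      \sum_a enorm ((Fij i a x - Fij i a (w i)) + v) ^+ 2.
    by apply: eq_bigr => a _; rewrite /v addrA.
  apply: (le_trans (mean_enorm_sq_le m_gt0 _ _)).
  have -> : m%:R^-1 *: (\sum_a (Fij i a x - Fij i a (w i))) + v = mi i.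
    rewrite /v sumrB scalerBr -/(mean_op (Fij i) x) -/(mean_op (Fij i) (w i)).
    by rewrite /mi FiE addrA subrK.
  rewrite lerD2l /Ax /Aw mulrCA [2 * (_ * _)]mulrCA -mulrDr ler_pM2l ?invr_gt0//.
  rewrite !mulr_sumr -big_split/=; apply: ler_sum => a _; exact: enorm_sqB2.
- by move=> i; rewrite mulr_ge0 ?sumr_ge0 ?invr_ge0 ?ler0n// => a _; exact: sqr_ge0.
- by move=> i; exact: sqr_ge0.
Qed.

(** * From one step to all iterates *)

Variables (x0 : 'rV[R]_d) (h0 w0 : 'I_n -> 'rV[R]_d).
Let S k t := vr_diana_sgda Fij r gamma alpha Q j xi b x0 h0 w0 k t.

(** Server and workers add the same realizations of the messages, so the relation assumed by
    [one_step] propagates from the initial state. *)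
Lemma st_h_mean k t : st_h (S k t) = n%:R^-1 *: \sum_(i < n) st_hi (S k t) i.
Proof.
elim: k => [//|k ih].
rewrite [S k.+1 t]/(step k t (S k t)) /= big_split/= -scaler_sumr scalerDr scalerA.
by rewrite ih (mulrC alpha).
Qed.

(** The list [L] only has to contain the labels of earlier times, so it stays fixed while [k]
    decreases in the induction, and a single sigma-algebra serves all the steps. *)
Lemma state_measurable_iterate (L : seq _) k :
  (forall l, (label_time l < k)%N -> l \in L) ->
  state_measurable (S k : sigma_of (sampling_events j xi b) L -> diana_state R d n).
Proof.
elim: k => [|k ih] kL; first by split => *; exact: bmeasurable_cst.
apply: (state_measurable_step alpha Fij_borel (compressor_measurable Q_compressor) mprox).
- by apply: ih => l lk; apply: kL; exact: ltnW.
- by move=> i a; apply: measurable_index; exact: kL.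
- by move=> i; apply: measurable_seed; exact: kL.
- by move=> i; apply: measurable_coin; exact: kL.
Qed.

Lemma state_measurable_iterateT k : state_measurable (S k).
Proof.
have kL l : (label_time l < k)%N -> l \in labels_before n k.
  by rewrite mem_labels_before.
have [mx mh mhi mw] := state_measurable_iterate kL.
have mid := measurable_sigma_of (L := labels_before n k)
  (sampling_events_measurable sampling).
split => [||i|i]; [exact: (measurableT_comp mx mid)|exact: (measurableT_comp mh mid)
  |exact: (measurableT_comp (mhi i) mid)|exact: (measurableT_comp (mw i) mid)].
Qed.

Lemma measurable_lyapunov_iterate k :
  measurable_fun [set: Omega] (fun t => lyap (S k t)).
Proof.
exact: (@measurable_lyapunov _ _ _ _ Fij Fi xs M _ _ _ Fij_borel
  (state_measurable_iterateT k)).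
Qed.

Lemma lyapunov_decrease k :
  ('E_P[fun t => lyap (S k.+1 t)] <= rho%:E * 'E_P[fun t => lyap (S k t)])%E.
Proof.
pose L1 := labels_before n k; pose L2 := labels_at n k.
pose E := sampling_events j xi b.
(* Off the diagonal, the first point determines the state at time [k] and the second one the samples
   of time [k]; on the diagonal this is the next value of the Lyapunov function. *)
pose f (z : sigma_of E L1 * sigma_of E L2) : \bar R := (lyap (step k z.2 (S k z.1)))%:E.
have L1P l : (label_time l < k)%N -> l \in L1 by rewrite mem_labels_before.
have L2P l : label_time l = k -> l \in L2 by rewrite mem_labels_at => ->.
have mf : measurable_fun [set: sigma_of E L1 * sigma_of E L2] f.
  suff mS : state_measurable (fun z : sigma_of E L1 * sigma_of E L2 =>
      step k z.2 (S k z.1)).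
    apply/measurable_EFinP.
    exact: (@measurable_lyapunov _ _ _ _ Fij Fi xs M _ _ _ Fij_borel mS).
  have [mx mh mhi mw] := state_measurable_iterate L1P.
  have m1 := @measurable_fst _ _ (sigma_of E L1) (sigma_of E L2).
  have m2 := @measurable_snd _ _ (sigma_of E L1) (sigma_of E L2).
  apply: (state_measurable_step alpha Fij_borel (compressor_measurable Q_compressor)
    mprox (S := fun z : sigma_of E L1 * sigma_of E L2 => S k z.1)
    (jr := fun z i => j k i z.2) (zr := fun z i => xi k i z.2) (br := fun z => b k z.2)).
  - split => [||i|i]; [exact: (measurableT_comp mx m1)|exact: (measurableT_comp mh m1)
      |exact: (measurableT_comp (mhi i) m1)|exact: (measurableT_comp (mw i) m1)].
  - move=> i a; rewrite -[X in measurable X]setTI.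
    apply: (m2 measurableT ((j k i : sigma_of E L2 -> 'I_m) @^-1` [set a])).
    by apply: measurable_index; exact: L2P.
  - by move=> i; apply: measurableT_comp m2; apply: measurable_seed; exact: L2P.
  - move=> i; rewrite -[X in measurable X]setTI.
    apply: (m2 measurableT ([set t | b k t i] : set (sigma_of E L2))).
    by apply: measurable_coin; exact: L2P.
have f0 z : (0 <= f z)%E by rewrite lee_fin lyapunov_ge0.
rewrite unlock.
have -> : (\int[P]_t (lyap (S k.+1 t))%:E = \int[P]_t f (t, t))%E by [].
rewrite (ge0_integral_decouple sampling (uniq_labels n k) mf f0).
(* After decoupling, both integrals are taken over [Omega] with its full sigma-algebra, so
   measurability is transported along the identity maps into the two coarser spaces before the outer
   integrals are compared. *)
have mfO : measurable_fun [set: Omega * Omega] (f : Omega * Omega -> \bar R).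
  have id1 := measurable_sigma_of (L := L1) (sampling_events_measurable sampling).
  have id2 := measurable_sigma_of (L := L2) (sampling_events_measurable sampling).
  have idP : measurable_fun [set: Omega * Omega]
      (fun z : Omega * Omega => (z.1, z.2) : sigma_of E L1 * sigma_of E L2).
    apply: measurable_fun_pair.
      exact: (measurableT_comp id1 measurable_fst).
    exact: (measurableT_comp id2 measurable_snd).
  have := measurableT_comp mf idP.
  by congr measurable_fun; apply/funext => -[].
rewrite -ge0_integralZl//; last 2 first.
- by apply/measurable_EFinP; exact: measurable_lyapunov_iterate.
- by move=> t _; rewrite lee_fin lyapunov_ge0.
apply: ge0_le_integral => //.
- by move=> t _; exact: integral_ge0.
- have := measurable_fun_fubini_tonelli_F (m2 := P) (f : Omega * Omega -> \bar R) mfO f0.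
  exact.
- apply: measurable_funeM; apply/measurable_EFinP; exact: measurable_lyapunov_iterate.
- move=> t _; rewrite -EFinM; have := one_step k (st_h_mean k t).
  by rewrite unlock.
Qed.

Lemma lyapunov_decay k :
  ('E_P[fun t => (enorm (st_x (S k t) - xs) ^+ 2)%R] <=
   (rho ^+ k * lyap {| st_x := x0; st_h := n%:R^-1 *: \sum_(i < n) h0 i;
      st_hi := h0; st_w := w0 |})%:E)%E.
Proof.
set V0 := lyap _.
have decay : ('E_P[fun t => lyap (S k t)] <= (rho ^+ k * V0)%:E)%E.
  elim: k => [|k ih]; first by
    rewrite expr0 mul1r (_ : (fun t => _) = cst V0)// expectation_cst.
  apply: (le_trans (lyapunov_decrease k)).
  by rewrite exprS -mulrA EFinM lee_wpmul2l.
apply: le_trans decay; rewrite unlock; apply: ge0_le_integral => //.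
- by move=> t _; rewrite lee_fin sqr_ge0.
- apply/measurable_EFinP; apply: measurable_enorm_sq; apply: bmeasurableB.
    by have [] := state_measurable_iterateT k.
  exact: bmeasurable_cst.
- by apply/measurable_EFinP; exact: measurable_lyapunov_iterate.
- move=> t _; rewrite lee_fin lerDl mulr_ge0// addr_ge0// mulr_ge0//;
    rewrite ?invr_ge0 ?mulr_ge0 ?ler0n//; apply: sumr_ge0 => i _; first exact: sqr_ge0.
  by apply: sumr_ge0 => a _; exact: sqr_ge0.
Qed.

End one_step.

Theorem theoremG19 (R : realType) (d n m : nat) (n_gt0 : (0 < n)%N)
    (m_gt0 : (0 < m)%N)
    (Fij : 'I_n -> 'I_m -> 'rV[R]_d -> 'rV[R]_d)
    (Fi : 'I_n -> 'rV[R]_d -> 'rV[R]_d) (F : 'rV[R]_d -> 'rV[R]_d)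
    (FiE : forall i, Fi i = mean_op (Fij i)) (FE : F = mean_op Fi)
    (Fij_borel : forall i j,
       measurable_fun [set: borel R d] (Fij i j : borel R d -> borel R d))
    (r : 'rV[R]_d -> \bar R) (r_proper : proper_efun r)
    (r_lsc : lower_semicontinuous r) (r_convex : econvex r)
    (X : set 'rV[R]_d) (XE : X = rvi_solutions F r)
    (xs : 'rV[R]_d) (X1 : X = [set xs])
    (mu ell ellhat elltilde : R) (mu_gt0 : 0 < mu) (ell_gt0 : 0 < ell)
    (ellhat_gt0 : 0 < ellhat) (elltilde_gt0 : 0 < elltilde)
    (F_qsm : quasi_strongly_monotone X mu F)
    (F_cocoercive : star_cocoercive X ell F)
    (Fi_cocoercive : forall x,
       n%:R^-1 * (\sum_(i < n) enorm (Fi i x - Fi i (metric_proj X x)) ^+ 2)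
       <= ellhat * dot (F x - F (metric_proj X x)) (x - metric_proj X x))
    (Fij_cocoercive : forall x,
       (n%:R * m%:R)^-1 *
         (\sum_(i < n) \sum_(j < m)
            enorm (Fij i j x - Fij i j (metric_proj X x)) ^+ 2)
       <= elltilde * dot (F x - F (metric_proj X x)) (x - metric_proj X x))
    (dO dX : measure_display) (Omega : measurableType dO)
    (Xi : measurableType dX) (P : probability Omega R)
    (nu : probability Xi R) (omega : R) (omega_ge0 : 0 <= omega)
    (Q : 'rV[R]_d -> Xi -> 'rV[R]_d)
    (Q_compressor : unbiased_compressor nu omega Q)
    (p : R) (p_gt0 : 0 < p) (p_le1 : p <= 1)
    (j : nat -> 'I_n -> Omega -> 'I_m)
    (xi : nat -> 'I_n -> {RV P >-> Xi})
    (b : nat -> Omega -> {ffun 'I_n -> bool})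
    (sampling : vr_diana_sampling nu p j xi b)
    (gamma alpha : R) (alpha_gt0 : 0 < alpha)
    (alpha_le : alpha <= Num.min (p / 3) (1 / (1 + omega)))
    (gamma_gt0 : 0 < gamma)
    (gamma_le : gamma <=
       (ell + 10 * (omega + 1) * (ellhat + elltilde) / n%:R
        + 4 * (omega + 1) * p * elltilde / (alpha * n%:R))^-1)
    (x0 : 'rV[R]_d) (h0 w0 : 'I_n -> 'rV[R]_d) (k : nat) :
  let xk := fun t : Omega =>
    st_x (vr_diana_sgda Fij r gamma alpha Q j xi b x0 h0 w0 k t) in
  let sigma0sq :=
    n%:R^-1 * (\sum_(i < n) enorm (h0 i - Fi i xs) ^+ 2)
    + (n%:R * m%:R)^-1 *
        (\sum_(i < n) \sum_(j < m) enorm (Fij i j (w0 i) - Fij i j xs) ^+ 2) in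
  let V0 := enorm (x0 - xs) ^+ 2
    + 4 * (omega + 1) * gamma ^+ 2 / (n%:R * alpha) * sigma0sq in
  ('E_P[fun t => (enorm (xk t - xs) ^+ 2)%R]
     <= ((1 - Num.min (gamma * mu) (alpha / 2)) ^+ k * V0)%R%:E)%E.
Proof.
cbv zeta.
have projE x : metric_proj X x = xs by rewrite X1 metric_proj1.
have /= xs_sol x : (0 <= (dot (F xs) (x - xs)%R)%:E + r x - r xs)%E.
  by move: x; change (rvi_solutions F r xs); rewrite -XE X1.
have [rN _] := r_proper.
have r_xs : r xs \is a fin_num.
  rewrite fin_numE rN/=; apply/negP => /eqP rxs.
  by have := xs_sol xs; rewrite rxs.
(* The variational inequality says that [- F xs] is a subgradient of [r] at [xs]; it serves both the
   existence of the prox and the comparison of its values with [xs]. *)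
have r_minorant z : (r xs - (dot (F xs) (z - xs))%R%:E <= r z)%E.
  have := xs_sol z; move: (rN z); rewrite -(fineK r_xs).
  case: (r z) => [a| |]//= _ h; last by rewrite leey.
  by move: h; rewrite -?EFinN -?EFinD !lee_fin; lra.
apply: (lyapunov_decay n_gt0 m_gt0 FiE FE Fij_borel mu_gt0 ell_gt0 ellhat_gt0
  elltilde_gt0 _ _ _ _ omega_ge0 Q_compressor p_gt0 p_le1 sampling alpha_gt0
  alpha_le gamma_gt0 gamma_le).
- by move=> x; have := F_qsm x; rewrite projE.
- by move=> x; have := F_cocoercive x; rewrite projE.
- by move=> x; have := Fi_cocoercive x; rewrite projE.
- by move=> x; have := Fij_cocoercive x; rewrite projE.
- by move=> x; exact: prox_dist_solution.
- apply: enorm_lipschitz_measurable => x y.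
  exact: (prox_nonexpansive r_proper r_lsc r_convex r_xs r_minorant).
Qed.
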